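(* Let $X$ be a normed linear space and $Y$ a Banach space, with $X\times Y$ normed by $\|(p,q)\|:=\sqrt{\|p\|^2+\|q\|^2}$. Let $S:X\rightrightarrows Y$ be locally closed at $(\bar x,\bar y)\in\mathrm{gph}(S)$, and let $H:X\rightrightarrows Y$ be positively homogeneous. Let $I$ be an index set and let $G_i:X\rightrightarrows Y$ be positively homogeneous for all $i\in I$. Consider the conditions: (1) $S$ is pseudo strictly $H$-differentiable at $(\bar x,\bar y)$. (2) $G_i(p)\cap[-H(-p)]\neq\emptyset$ for all $p\in X\setminus\{0\}$ and $i\in I$. Then the following hold: (a) Suppose $Y$ is finite dimensional and $H$ is compact-valued. If for all $i\in I$ there exists a sequence $\{(x_j,y_j)\}\subset\mathrm{gph}(S)$ such that $(x_j,y_j)\to(\bar x,\bar y)$ and $\limsup_{j\to\infty}T_{\mathrm{gph}(S)}(x_j,y_j)\subset\mathrm{gph}(G_i)$, then (1) implies (2). (b) Suppose $\|H\|^{+}$ is finite, $H$ is convex-valued, $X$ is complete, and the mapping $T_{\mathrm{gph}(S)}:\mathrm{gph}(S)\rightrightarrows X\times Y$ is $\{\mathrm{gph}(G_i)\}_{i\in I}$-isc at $(\bar x,\bar y)$. Then (2) implies (1). (a$'$) Suppose $X$ and $Y$ are finite dimensional Euclidean spaces and $H$ is compact-valued. If for all $i\in I$ there exists a sequence $\{(x_j,y_j)\}\subset\mathrm{gph}(S)$ such that $(x_j,y_j)\to(\bar x,\bar y)$ and $\limsup_{j\to\infty}\mathrm{cl}\,\mathrm{co}\,T_{\mathrm{gph}(S)}(x_j,y_j)\subset\mathrm{gph}(G_i)$,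 then (1) implies (2). (b$'$) Suppose $X$ and $Y$ are finite dimensional Euclidean spaces and $H$ is a prefan. If the mapping $\mathrm{cl}\,\mathrm{co}\,T_{\mathrm{gph}(S)}:\mathrm{gph}(S)\rightrightarrows X\times Y$ is $\{\mathrm{gph}(G_i)\}_{i\in I}$-isc at $(\bar x,\bar y)$, then (2) implies (1).
   Context: A set-valued map $S:X\rightrightarrows Y$ assigns to each $x\in X$ a subset $S(x)\subset Y$ (possibly empty); its graph is $\mathrm{gph}(S)=\{(x,y)\mid y\in S(x)\}$. $S$ is locally closed at $(\bar x,\bar y)\in\mathrm{gph}(S)$ if $\mathrm{gph}(S)\cap\mathbb{B}_\epsilon((\bar x,\bar y))$ is closed for some $\epsilon>0$, where $\mathbb{B}_\epsilon(z)$ is the closed ball of radius $\epsilon$ centered at $z$; $\mathbb{B}$ is the closed unit ball. A map is compact-valued (convex-valued) if each of its values is compact (convex). $H:X\rightrightarrows Y$ is positively homogeneous if $0\in H(0)$ and $H(kw)=kH(w)$ for all $k>0$, $w\in X$. For a real $\delta>0$, $(H+\delta)(w):=H(w)+\delta\|w\|\mathbb{B}$. The outer norm is $\|H\|^{+}:=\sup_{\|w\|\le1}\sup_{z\in H(w)}\|z\|$. A prefan (between finite dimensional Euclidean spaces) is a positively homogeneous map $H$ such that $H(p)$ is nonempty, convex and compact for all $p$, and $\|H\|^{+}$ is finite. $S$ is pseudo strictly $H$-differentiable at $(\bar x,\bar y)\in\mathrm{gph}(S)$ if for any $\delta>0$ there are neighborhoods $U_\delta$ of $\bar x$ and $V_\delta$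 of $\bar y$ such that $S(x)\cap V_\delta\subset S(x')+(H+\delta)(x-x')$ for all $x,x'\in U_\delta$. For a subset $C$ of a normed space and $\bar z\in C$, the tangent (contingent) cone $T_C(\bar z)$ is the set of $w$ such that $(z_i-\bar z)/\tau_i\to w$ for some $z_i\to\bar z$, $z_i\in C$, $\tau_i\searrow0$. $\mathrm{cl}\,\mathrm{co}$ denotes the closed convex hull; $\mathrm{cl}\,\mathrm{co}\,T_{\mathrm{gph}(S)}$ is the map $(x,y)\mapsto\mathrm{cl}\,\mathrm{co}\,T_{\mathrm{gph}(S)}(x,y)$. For a sequence of sets $A_j$, $\limsup_{j\to\infty}A_j$ is the outer limit: the set of all limits of sequences $z_{k}\in A_{j_k}$ along subsequences $j_1<j_2<\cdots$. Generalized inner semicontinuity: let $Z,W$ be normed spaces, $C\subset Z$, $\bar z\in C$, and let $\{T_i\}_{i\in I}$ be a family of subsets of $W$. A closed-valued map $R:C\rightrightarrows W$ is $\{T_i\}_{i\in I}$-inner semicontinuous ($\{T_i\}_{i\in I}$-isc) at $\bar z$ (with respect to $C$) if for all $\rho>0$ and $\epsilon>0$ there is a neighborhood $N$ of $\bar z$ such that for all $z\in C\cap N$ there is some $i\in I$ with $T_i\cap\rho\mathbb{B}\subset R(z)+\epsilon\mathbb{B}$. *)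

(* Defs.v *)
From HB Require Import structures.
From mathcomp Require Import all_boot all_order all_algebra sesquilinear.
From mathcomp Require Import all_classical all_reals all_analysis.

Set Implicit Arguments.
Unset Strict Implicit.
Unset Printing Implicit Defensive.

Import Order.TTheory GRing.Theory Num.Theory.
Import numFieldNormedType.Exports.

Local Open Scope classical_set_scope.
Local Open Scope ring_scope.

(* A set-valued map from X to Y is a function [X -> set Y]. *)

Definition gph (X Y : Type) (S : X -> set Y) : set (X * Y) :=
  [set z | S z.1 z.2].

Definition set_sum (V : zmodType) (A B : set V) : set V :=
  [set a + b | a in A & b in B].

(* The canonical norm of [X * Y] in the library is the max norm. It induces the
   same topology as [norm2], so [nbhs], [closed], [closure] and [-->] are the
   library ones on [X * Y], while balls of [X * Y] are taken for [norm2]. *)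
Definition norm2 (R : realType) (X Y : normedModType R) (z : X * Y) : R :=
  Num.sqrt (`|z.1| ^+ 2 + `|z.2| ^+ 2).

Definition finite_dim (R : realType) (V : lmodType R) : Prop :=
  exists n : nat, inhabited (Vector.axiom n V).

Definition euclidean_space (R : realType) (V : normedModType R) : Prop :=
  finite_dim V /\
  exists dot : {dot V for idfun}, forall v : V, `|v| ^+ 2 = dot v v.

(* Same condition as the library's [cauchy_cvg]. *)
Definition complete_space (R : realType) (V : normedModType R) : Prop :=
  forall F : set_system V, ProperFilter F -> cauchy F -> cvg F.

Definition locally_closed_at (R : realType) (X Y : normedModType R)
    (S : X -> set Y) (z : X * Y) : Prop :=
  exists2 e : R, 0 < e & closed (gph S `&` closed_ball_ (@norm2 R X Y) z e).

Definition pos_homogeneous (R : realType) (X Y : normedModType R)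
    (H : X -> set Y) : Prop :=
  H 0 0 /\ forall (k : R) (w : X), 0 < k -> H (k *: w) = *:%R k @` H w.

Definition map_enlarge (R : realType) (X Y : normedModType R)
    (H : X -> set Y) (delta : R) (w : X) : set Y :=
  set_sum (H w) (closed_ball_ Num.norm 0 (delta * `|w|)).

Definition outer_norm (R : realType) (X Y : normedModType R)
    (H : X -> set Y) : \bar R :=
  ereal_sup [set ereal_sup [set `|z|%:E | z in H w]
            | w in closed_ball_ Num.norm (0 : X) 1].

Definition compact_valued (T : Type) (V : topologicalType) (H : T -> set V)
    : Prop :=
  forall w, compact (H w).

Definition convex_valued (R : realType) (T : Type) (V : lmodType R)
    (H : T -> set V) : Prop :=
  forall w, @convex_set R V (H w).

Definition prefan (R : realType) (X Y : normedModType R) (H : X -> set Y)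
    : Prop :=
  [/\ pos_homogeneous H,
      forall p, [/\ H p !=set0, @convex_set R Y (H p) & compact (H p)] &
      outer_norm H \is a fin_num].

Definition pseudo_strictly_differentiable (R : realType)
    (X Y : normedModType R) (S H : X -> set Y) (xbar : X) (ybar : Y) : Prop :=
  forall delta : R, 0 < delta ->
    exists (U : set X) (V : set Y),
      [/\ nbhs xbar U, nbhs ybar V &
          forall x x', U x -> U x' ->
            S x `&` V `<=` set_sum (S x') (map_enlarge H delta (x - x'))].

Definition tangent_cone (R : realType) (W : normedModType R) (C : set W)
    (zbar : W) : set W :=
  [set w | exists (z : nat -> W) (tau : nat -> R),
     [/\ forall i, C (z i), z @ \oo --> zbar, forall i, 0 < tau i,
         tau @ \oo --> (0 : R) &
         (tau i)^-1 *: (z i - zbar) @[i --> \oo] --> w]].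

Definition clco (R : realType) (W : normedModType R) (A : set W) : set W :=
  closure (smallest (@convex_set R W) A).

Definition outer_limit (T : topologicalType) (A : nat -> set T) : set T :=
  [set w | exists (k : nat -> nat) (z : nat -> T),
     [/\ {homo k : m n / (m < n)%N}, forall n, A (k n) (z n) &
         z @ \oo --> w]].

(* Balls of [W] are taken for the norm [N], which need not be the canonical norm
   of [W]. Only the values of [M] on [C] are involved. *)
Definition family_isc (R : realType) (Z W : normedModType R) (N : W -> R)
    (I : Type) (T : I -> set W) (C : set Z) (M : Z -> set W) (zbar : Z)
    : Prop :=
  (forall z, C z -> closed (M z)) /\
  forall rho eps : R, 0 < rho -> 0 < eps ->
    exists2 V : set Z, nbhs zbar V &
      forall z, (C `&` V) z ->
        exists i : I,
          T i `&` closed_ball_ N 0 rho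
            `<=` set_sum (M z) (closed_ball_ N 0 eps).

(* Main.v *)
(* For (a), pseudo strict differentiability applied between x_j and x_j + t p
   yields points of the graph over x_j + t p; compactness turns their difference
   quotients into tangent vectors (p, q_j) with q_j close to -H(-p), and a
   cluster point of the q_j is the required element.

   For (b) and (b'), both semicontinuity assumptions imply that near the base
   point every point z of the graph can be moved inside the graph, for
   arbitrarily short times t and up to an error eps t, along t (p, -h) with
   h in H(-p). For T this is immediate. For cl co T it follows from an explicit
   Euler scheme: at a nearest point of the graph the residual is a proximal
   normal, hence polar to cl co T, so the distance to the graph stays O(eps t).
   By an Ekeland-type maximality argument such short moves are glued together:
   first in the fixed direction x' - x, where convexity of H keeps the
   accumulated displacement in the enlargement of H(x - x'), which reaches a
   point over some x'' with |x'' - x'| = O(eps |x' - x|); then, always heading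
   towards x', to a point over x' itself, at the cost of a displacement bounded
   by a constant times |x'' - x'|. *)

Require Import Defs.
From HB Require Import structures.
From mathcomp Require Import all_boot all_order all_algebra sesquilinear.
From mathcomp Require Import all_classical all_reals all_analysis.
From mathcomp Require Import lra ring.

Import Order.TTheory GRing.Theory Num.Theory.
Import numFieldNormedType.Exports.

Local Open Scope classical_set_scope.
Local Open Scope ring_scope.

(** * Sequential convergence, completeness and compactness in normed spaces *)

Lemma cvgn_distP {R : realType} {V : normedModType R} (u : nat -> V) (l : V) :
  u @ \oo --> l <->
  forall e : R, 0 < e -> exists N, forall n, (N <= n)%N -> `|l - u n| <= e.
Proof.
split=> [/cvgrPdist_le ul e e0|h].
  by have [N _ hN] := ul _ e0; exists N => n; apply: hN.
by apply/cvgrPdist_le => e e0; have [N hN] := h _ e0; exists N.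
Qed.

Lemma natSinv_le {R : realType} (e : R) : 0 < e ->
  exists N, forall n, (N <= n)%N -> n.+1%:R^-1 <= e.
Proof.
move=> e0; have [N _ hN] := near_infty_natSinv_lt (PosNum e0).
by exists N => n /hN /ltW.
Qed.

(** Common form of completeness for the complete [X] of (b), the finite dimensional [X] of (b') and
    the Banach space [Y]. It passes to products, and its Cauchy condition is anchored at [u N],
    which is what bounded monotone functionals deliver. *)
Definition seq_complete {R : realType} (V : normedModType R) : Prop :=
  forall u : nat -> V,
    (forall e : R, 0 < e ->
       exists N, forall n, (N <= n)%N -> `|u N - u n| <= e) ->
    exists l : V, u @ \oo --> l.

Lemma complete_seq_complete {R : realType} (V : normedModType R) :
  complete_space V -> seq_complete V.
Proof.
move=> cV u uc; suff /cV ucvg : cauchy (u @ \oo) by exists (lim (u @ \oo)).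
apply: cauchy_exP => e e0.
have [N hN] := uc (e / 2) ltac:(lra).
exists (u N); exists N => // n /= /hN h.
by rewrite -ball_normE /=; lra.
Qed.

Lemma completeNormedMod_seq_complete {R : realType}
  (V : completeNormedModType R) : seq_complete V.
Proof. by apply: complete_seq_complete => F FF; apply: cauchy_cvg. Qed.

Lemma prod_norm_le {R : realType} {V W : normedModType R} (z : V * W) (e : R) :
  (`|z| <= e) = (`|z.1| <= e) && (`|z.2| <= e).
Proof. by rewrite prod_normE ge_max. Qed.

Lemma seq_complete_prod {R : realType} (V W : normedModType R) :
  seq_complete V -> seq_complete W -> seq_complete (V * W)%type.
Proof.
move=> cV cW u uc.
have [l ul] : exists l : V, (fun n => (u n).1) @ \oo --> l.
  apply: cV => e /uc[N hN]; exists N => n /hN.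
  by rewrite prod_norm_le => /andP[].
have [m um] : exists l : W, (fun n => (u n).2) @ \oo --> l.
  apply: cW => e /uc[N hN]; exists N => n /hN.
  by rewrite prod_norm_le => /andP[].
exists (l, m); apply/cvgn_distP => e e0.
have [N hN] := (cvgn_distP _ _).1 ul _ e0.
have [M hM] := (cvgn_distP _ _).1 um _ e0.
exists (maxn N M) => n; rewrite geq_max => /andP[/hN h1 /hM h2].
by rewrite prod_norm_le /= h1 h2.
Qed.

Lemma compact_cluster_seq {R : realType} {V : normedModType R} (A : set V)
    (u : nat -> V) :
  compact A -> (forall n, A (u n)) ->
  exists2 l, A l & forall (e : R) N, 0 < e ->
    exists2 n, (N <= n)%N & `|l - u n| <= e.
Proof.
move=> cA Au; have [|l [Al cl]] := cA (u @ \oo) _; first by exists 0%N => // n _; apply: Au.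
exists l => // e N e0.
have /= := cl (u @` [set n | (N <= n)%N]) (ball l e) _ (nbhsx_ballx _ _ e0).
case; first by exists N => // n Nn; exists n.
move=> _ [[n Nn <-]]; rewrite -ball_normE /= => /ltW h.
by exists n.
Qed.

(** Finite dimension is given only algebraically, so the norms must be compared: the coordinate
    isomorphism [g] is continuous and bounded below by a multiple of the norm. The ball is then a
    closed subset of the image under [g] of a compact ball of row vectors. *)
Lemma compact_closed_ball {R : realType} (V : normedModType R) (r : R) :
  finite_dim V -> compact [set v : V | `|v| <= r].
Proof.
move=> [n [[f flin [g fK gK]]]].
have glin : linear g.
  by move=> a u v; apply: (can_inj fK); rewrite flin !gK.
pose gL : {linear 'rV[R]_n -> V} :=
  HB.pack g (GRing.isLinear.Build _ _ _ _ g glin).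
have g0 : g 0 = 0 by exact: (linear0 gL).
have gZ a w : g (a *: w) = a *: g w by exact: (linearZ_LR gL).
have mxle (w : 'rV[R]_n) i : `|w 0 i| <= `|w|.
  rewrite [leRHS]/Num.norm /= mx_normrE.
  by apply/bigmax_geP; right => /=; exists (0, i).
have gc : continuous g.
  apply: (bounded_linear_continuous (f := gL)); apply/linear_boundedP.
  exists (\sum_i `|g (delta_mx 0 i)|); split; first exact: num_real.
  move=> C /ltW hC w; apply: le_trans (ler_wpM2r (normr_ge0 _) hC).
  rewrite {1}(row_sum_delta w) linear_sum mulr_suml.
  apply: le_trans (ler_norm_sum _ _ _) _; apply: ler_sum => i _.
  by rewrite linearZ normrZ mulrC ler_wpM2l.
pose Sph := [set w : 'rV[R]_n | `|w| = 1].
have [c c0 hc] : exists2 c : R, 0 < c & forall w, c * `|w| <= `|g w|.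
  (* The constant [c] is the minimum of the norm of [g] on the unit sphere. An empty sphere means
     that the space is trivial, and then any constant will do. *)
  have [[w0 Sw0]|Sph0] := pselect (exists w, Sph w); last first.
    exists 1 => // w; have [->|w0] := eqVneq w 0.
      by rewrite normr0 mulr0.
    case: Sph0; exists (`|w|^-1 *: w).
    by rewrite /Sph /= normrZ normfV normr_id mulVf ?normr_eq0.
  have cS : compact Sph.
    apply: bounded_closed_compact.
      exists 1; split; first exact: num_real.
      by move=> M M1 w /= ->; exact: ltW.
    apply: (@preimage_closed _ _ (fun w : 'rV[R]_n => `|w|) [set 1]).
      by move=> w _; exact: norm_continuous.
    exact: closed_eq.
  have gn : continuous (fun w => `|g w|).
    by move=> w; apply: continuous_comp; [exact: gc|exact: norm_continuous].
  have [w1 /set_mem Sw1 hw1] := compact_EVT_min (ex_intro _ w0 Sw0) cS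
    (continuous_subspaceT gn).
  have w1n0 : w1 != 0 by rewrite -normr_eq0 Sw1 oner_neq0.
  have gw10 : 0 < `|g w1|.
    rewrite normr_gt0; apply/eqP => gw; move/eqP: w1n0; apply.
    by apply: (can_inj gK); rewrite gw g0.
  exists `|g w1| => // w; have [->|w0'] := eqVneq w 0.
    by rewrite normr0 mulr0.
  have := hw1 (`|w|^-1 *: w); rewrite in_setE /Sph /=.
  rewrite normrZ normfV normr_id mulVf ?normr_eq0// => /(_ erefl).
  by rewrite gZ normrZ normfV normr_id ler_pdivlMl ?normr_gt0 // mulrC.
apply: (@subclosed_compact _ _ (g @` [set w | `|w| <= r / c])).
- apply: (@preimage_closed _ _ (fun w : V => `|w|) [set x | x <= r]).
    by move=> w _; exact: norm_continuous.
  exact: closed_le.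
- apply: continuous_compact; first exact: continuous_subspaceT.
  apply: bounded_closed_compact.
    exists (r / c); split; first exact: num_real.
    by move=> M M1 w /= h; exact: le_trans h (ltW M1).
  apply: (@preimage_closed _ _ (fun w : 'rV[R]_n => `|w|) [set x | x <= r / c]).
    by move=> w _; exact: norm_continuous.
  exact: closed_le.
- move=> v /= vr; exists (f v) => //=.
  by rewrite ler_pdivlMr // mulrC (le_trans (hc _)) // fK.
Qed.

(** A tail of a Cauchy sequence lies in a compact ball, and any cluster point of it is the limit. *)
Lemma finite_dim_seq_complete {R : realType} (V : normedModType R) :
  finite_dim V -> seq_complete V.
Proof.
move=> fV u uc; have [N0 hN0] := uc 1 ltr01.
pose v n := u (N0 + n)%N.
have [|l _ hl] := @compact_cluster_seq _ _ _ v
    (compact_closed_ball V (`|u N0| + 1) fV).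
  move=> n /=; have := hN0 _ (leq_addr n N0); rewrite /v.
  by have := ler_distD (u N0) 0 (u (N0 + n)%N); rewrite !sub0r !normrN; lra.
exists l; apply/cvgn_distP => e e0.
have [N hN] := uc (e / 3) ltac:(lra).
have [n Nn hn] := hl (e / 3) N ltac:(lra).
exists N => m Nm; have h1 := hN _ Nm.
have h2 := hN _ (leq_trans Nn (leq_addl N0 n)).
have := ler_distD (v n) l (u m); have := ler_distD (u N) (v n) (u m).
by rewrite (distrC (v n) (u N)) /v in hn h2 *; lra.
Qed.

(** * Convex combinations, and linear identities between vectors by reflection *)

Lemma convex_set_comb {R : realType} {V : lmodType R} (A : set V) (a b : R)
    (x y : V) :
  @convex_set R V A -> A x -> A y -> 0 <= a -> 0 <= b -> a + b = 1 ->
  A (a *: x + b *: y).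
Proof.
move=> cA Ax Ay a0 b0 ab1.
have a01 : Itv.spec (@Itv.num_sem R) (Itv.Real `[0%Z, 1%Z]) a.
  by rewrite /= /Itv.num_sem num_real /= in_itv /=; apply/andP; split; lra.
have := cA x y (Itv.mk a01); rewrite !in_setE => /(_ Ax Ay).
have -> : b = 1 - a by lra.
exact: id.
Qed.

Lemma convex_set_intro {R : realType} {V : lmodType R} (A : set V) :
  (forall x y (a b : R), A x -> A y -> 0 <= a -> 0 <= b -> a + b = 1 ->
     A (a *: x + b *: y)) -> @convex_set R V A.
Proof.
move=> h x y l; rewrite !in_setE => Ax Ay.
have l1 : 0 <= 1 - l%:num by rewrite subr_ge0.
have l2 : l%:num + (1 - l%:num) = 1 by rewrite addrC subrK.
exact: h.
Qed.

(** Syntax trees for linear combinations of vectors taken from a list of atoms. Two trees with the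
    same coefficient at every atom evaluate to the same vector, which turns a vector identity into
    scalar ones. *)
Inductive lexpr (R : Type) :=
  | LAtom of nat | LZero | LAdd of lexpr R & lexpr R | LOpp of lexpr R
  | LScale of R & lexpr R.
Arguments LAtom {R}. Arguments LZero {R}. Arguments LAdd {R}.
Arguments LOpp {R}. Arguments LScale {R}.

Fixpoint lcoef {R : pzRingType} (e : lexpr R) (k : nat) : R :=
  match e with
  | LAtom n => if eqn n k then 1 else 0
  | LZero => 0
  | LAdd a b => lcoef a k + lcoef b k
  | LOpp a => - lcoef a k
  | LScale c a => c * lcoef a k
  end.

Fixpoint leval {R : pzRingType} {V : lmodType R} (env : seq V) (e : lexpr R) :
    V :=
  match e with
  | LAtom n => nth 0 env n
  | LZero => 0
  | LAdd a b => leval env a + leval env b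
  | LOpp a => - leval env a
  | LScale c a => c *: leval env a
  end.

Fixpoint lcoef_eq {R : pzRingType} (n : nat) (a b : lexpr R) : Prop :=
  match n with
  | 0%N => True
  | m.+1 => lcoef a m = lcoef b m /\ lcoef_eq m a b
  end.

Lemma levalE {R : pzRingType} {V : lmodType R} (env : seq V) (e : lexpr R) :
  leval env e = \sum_(k < size env) lcoef e k *: env`_k.
Proof.
elim: e => [n||a IHa b IHb|a IHa|c a IHa] /=; rewrite ?IHa ?IHb.
- have [nle|ngt] := ltnP n (size env).
    rewrite (bigD1 (Ordinal nle)) //= eqnE eqxx scale1r big1 ?addr0 // => k.
    rewrite -val_eqE /= => kn; case: eqP => [nk|_].
      by rewrite nk eqxx in kn.
    by rewrite scale0r.
  rewrite nth_default // big1 // => k _.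
  rewrite eqnE; case: eqP => [nk|_]; last by rewrite scale0r.
  by have := ltn_ord k; rewrite -nk ltnNge ngt.
- by rewrite big1 // => k _; rewrite scale0r.
- by rewrite -big_split /=; apply: eq_bigr => k _; rewrite scalerDl.
- by rewrite -sumrN; apply: eq_bigr => k _; rewrite scaleNr.
- by rewrite scaler_sumr; apply: eq_bigr => k _; rewrite scalerA.
Qed.

Lemma leval_eq {R : pzRingType} {V : lmodType R} (env : seq V)
    (a b : lexpr R) :
  lcoef_eq (size env) a b -> leval env a = leval env b.
Proof.
rewrite !levalE => h; apply: eq_bigr => k _; congr (_ *: _).
by case: k => k /=; elim: (size env) h => //= n IH [hn /IH{}IH];
  rewrite ltnS leq_eqVlt => /predU1P[->|/IH].
Qed.

(* [lmodule] proves an identity between linear combinations of vectors by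
   reducing it to one [lra] goal for each vector atom. *)
Ltac lm_find x env n :=
  lazymatch env with
  | x :: _ => constr:(Some n)
  | _ :: ?l => lm_find x l (S n)
  | _ => constr:(@None nat)
  end.
Ltac lm_atoms V t env :=
  lazymatch t with
  | ?a + ?b => let e := lm_atoms V a env in lm_atoms V b e
  | - ?a => lm_atoms V a env
  | _ *: ?a => lm_atoms V a env
  | 0 => env
  | _ => lazymatch lm_find t env O with
         | Some _ => env | None => constr:(@cons V t env) end
  end.
Ltac lm_reify R t env :=
  lazymatch t with
  | ?a + ?b => let x := lm_reify R a env in let y := lm_reify R b env in
               constr:(@LAdd R x y)
  | - ?a => let x := lm_reify R a env in constr:(@LOpp R x)
  | ?c *: ?a => let x := lm_reify R a env in constr:(@LScale R c x)
  | 0 => constr:(@LZero R)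
  | _ => lazymatch lm_find t env O with Some ?n => constr:(@LAtom R n) end
  end.
Tactic Notation "lmodule" constr(R) :=
  lazymatch goal with
  | |- @eq ?V ?a ?b =>
    let env := lm_atoms V a (@nil V) in
    let env := lm_atoms V b env in
    let x := lm_reify R a env in
    let y := lm_reify R b env in
    change (leval env x = leval env y);
    apply: leval_eq; cbn [lcoef_eq lcoef size eqn];
    repeat split; lra
  end.

(** * A maximality principle of Ekeland type *)

(** Each [u n.+1] is chosen above [u n] with [phi] within [1/(n+1)] of its supremum over the
    successors of [u n]. Since [phi] increases along [u] and is bounded, the distance estimate makes
    [u] Cauchy. Its limit lies above every [u n], so nothing above the limit can have a larger
    [phi]. *)
Lemma maximal_element {R : realType} {E : normedModType R}
    (le : E -> E -> Prop) (phi : E -> R) (L B : R) (x0 : E) :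
  seq_complete E -> 0 < L ->
  (forall x, le x x) -> (forall x y z, le x y -> le y z -> le x z) ->
  (forall x y, le x y -> `|y - x| <= L * (phi y - phi x)) ->
  (forall y, le x0 y -> phi y <= B) ->
  (forall (u : nat -> E) l, (forall n m, (n <= m)%N -> le (u n) (u m)) ->
     u @ \oo --> l -> forall n, le (u n) l) ->
  exists2 x, le x0 x & forall y, le x y -> phi y <= phi x.
Proof.
move=> cE L0 lexx le_trans' le_dist phiB le_lim.
have phi_mono x y : le x y -> phi x <= phi y.
  move=> /le_dist h; rewrite -subr_ge0 -(pmulr_rge0 _ L0).
  exact: le_trans h.
(* The guard [le x0 nx.2] makes the statement total, so that a choice function exists; outside the
   guard any value is accepted. *)
have ex_next (nx : nat * E) : exists y, le x0 nx.2 -> le nx.2 y /\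
    forall w, le nx.2 w -> phi w <= phi y + nx.1.+1%:R^-1.
  case: nx => n x /=; have [xx|nx] := pselect (le x0 x); last by exists x => /nx.
  have supP : has_sup (phi @` [set w | le x w]).
    split; first by exists (phi x); exists x.
    by exists B => _ [w /= xw <-]; exact/phiB/le_trans'/xw.
  have e0 : 0 < n.+1%:R^-1 :> R by rewrite invr_gt0 ltr0n.
  have [_ [y /= xy <-] hy] := sup_adherent e0 supP.
  exists y => _; split=> // w xw.
  have : phi w <= sup (phi @` [set w | le x w]).
    by apply: ub_le_sup; [case: supP|exists w].
  move: hy; set sp := sup _; set e := _^-1; lra.
have [next nextP] := choice ex_next.
pose u := fix u n := if n is m.+1 then next (m, u m) else x0.
have u0 n : le x0 (u n).
  by elim: n => [|n IH] //=; apply: le_trans' IH (nextP (n, _) IH).1.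
have uS n : le (u n) (u n.+1) := (nextP (n, _) (u0 n)).1.
have ule n m : (n <= m)%N -> le (u n) (u m).
  move=> /subnK <-; elim: (m - n)%N => [|k IH]; first by rewrite add0n.
  by rewrite addSn; exact: le_trans' IH (uS _).
have [l ul] : exists l : E, u @ \oo --> l.
  apply: cE => e e0.
  have supP : has_sup (range (phi \o u)).
    split; first by exists (phi x0); exists 0%N.
    by exists B => _ [n _ <-]; exact/phiB/u0.
  have eL : 0 < e / L by rewrite divr_gt0.
  have [_ [N _ <-] hN] := sup_adherent eL supP.
  exists N => n Nn; rewrite distrC; apply: le_trans (le_dist _ _ (ule _ _ Nn)) _.
  rewrite mulrC -ler_pdivlMr //.
  have : phi (u n) <= sup (range (phi \o u)).
    by apply: ub_le_sup; [case: supP|exists n].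
  by move: hN => /=; lra.
exists l; first exact: (le_lim u l ule ul 0%N).
move=> y ly; apply/ler_addgt0Pr => e e0.
have [N hN] := natSinv_le _ e0.
have uy : le (u N) y by apply: le_trans' ly; exact: le_lim.
move: (phi_mono _ _ (le_lim u l ule ul N.+1)) (hN N (leqnn _)).
move: ((nextP (N, _) (u0 N)).2 _ uy) => /=; set a := _^-1.
by set b := phi (next _); lra.
Qed.

(** * From pseudo strict differentiability to tangent vectors: (a) and (a') *)

(** The subsequence is extracted recursively: stage [n] asks for precision [1/(n+1)] and for an
    index beyond the one just chosen. *)
Lemma outer_limit_frequently {R : realType} {V : normedModType R}
    (A : nat -> set V) (l : V) :
  (forall (e : R) N, 0 < e ->
     exists2 n, (N <= n)%N & exists2 w, A n w & `|l - w| <= e) ->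
  outer_limit A l.
Proof.
move=> h.
have ex_next (kN : nat * nat) : exists nw : nat * V,
    [/\ (kN.2 <= nw.1)%N, A nw.1 nw.2 & `|l - nw.2| <= kN.1.+1%:R^-1].
  have [|n Nn [w Aw lw]] := h kN.1.+1%:R^-1 kN.2.
    by rewrite invr_gt0 ltr0n.
  by exists (n, w).
have [f fP] := choice ex_next.
pose s := fix s n := if n is m.+1 then f (m.+1, (s m).1.+1) else f (0%N, 0%N).
have sP n : A (s n).1 (s n).2 /\ `|l - (s n).2| <= n.+1%:R^-1.
  by case: n => [|n] /=; [case: (fP (0%N, 0%N))|case: (fP (n.+1, (s n).1.+1))].
exists (fun n => (s n).1), (fun n => (s n).2); split.
- apply: (homo_ltn ltn_trans) => n /=.
  by case: (fP (n.+1, (s n).1.+1)).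
- by move=> n; case: (sP n).
- apply/cvgn_distP => e e0; have [N hN] := natSinv_le _ e0.
  by exists N => n /hN; apply: le_trans; case: (sP n).
Qed.

(** The quotients [r n = (y' - y) / t n] stay within [delta] of the compact set [- H (- p)], hence
    in a ball of [Y], and cluster at some [q]. One [delta] in the conclusion is the selection error,
    the other is the distance from [q] to some [r n]. *)
Lemma tangent_of_selection {R : realType} {X Y : normedModType R}
    {S H : X -> set Y} (x p : X) (y : Y) (delta t0 : R) :
  finite_dim Y -> compact (H (- p)) -> S x y -> 0 < delta -> 0 < t0 ->
  (forall t, 0 < t -> t <= t0 -> exists2 y', S (x + t *: p) y' &
     exists2 h, H (- p) h & `|y' - y + t *: h| <= delta * t) ->
  exists2 q, tangent_cone (gph S) (x, y) (p, q) &
    exists2 h, H (- p) h & `|q + h| <= 2 * delta.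
Proof.
move=> fY cH Sxy d0 t00 sel.
pose t (n : nat) : R := t0 * n.+1%:R^-1.
have tpos n : 0 < t n by rewrite mulr_gt0 // invr_gt0 ltr0n.
have tle n : t n <= t0.
  by rewrite -[leRHS]mulr1 ler_pM2l // invf_le1 ?ler1n ?ltr0n.
have ex_y n : exists yh : Y * Y, [/\ S (x + t n *: p) yh.1, H (- p) yh.2 &
    `|yh.1 - y + t n *: yh.2| <= delta * t n].
  by have [y' Sy' [h Hh yh]] := sel _ (tpos n) (tle n); exists (y', h).
have [f fP] := choice ex_y.
pose r n := (t n)^-1 *: ((f n).1 - y).
have rh n : `|r n + (f n).2| <= delta.
  have [_ _] := fP n.
  rewrite (_ : _ - y + _ = t n *: (r n + (f n).2)); last first.
    by rewrite scalerDr scalerA mulfV ?gt_eqF // scale1r.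
  by rewrite normrZ gtr0_norm // mulrC ler_pM2r.
have [M [_ HM]] := compact_bounded cH.
have hM n : `|(f n).2| <= M + 1 by have [_ h _] := fP n; apply: HM; [lra|].
have rM n : `|r n| <= M + 1 + delta.
  have := ler_normB (r n + (f n).2) (f n).2; rewrite addrK.
  by have := rh n; have := hM n; lra.
have [q _ qP] := compact_cluster_seq _ r (compact_closed_ball Y _ fY) rM.
have ex_k (k : nat) : exists n, (k <= n)%N /\ `|q - r n| <= k.+1%:R^-1.
  by have [|n kn hn] := qP k.+1%:R^-1 k; [rewrite invr_gt0 ltr0n|exists n].
have [g gP] := choice ex_k.
have tg e : 0 < e -> exists N, forall n, (N <= n)%N -> t (g n) <= e.
  move=> e0; have [|N hN] := natSinv_le (e / t0); first by rewrite divr_gt0.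
  exists N => n Nn; rewrite /t mulrC -ler_pdivlMr //; apply: hN.
  exact: leq_trans Nn (gP n).1.
exists q; last first.
  have [n _ qn] := qP delta 0%N d0; exists (f n).2; first by case: (fP n).
  have := ler_normD (q - r n) (r n + (f n).2).
  rewrite addrA subrK; have := rh n; lra.
exists (fun k => (x + t (g k) *: p, (f (g k)).1)), (t \o g); split.
- by move=> k; case: (fP (g k)).
- apply/cvgn_distP => e e0.
  (* The divisor dominates the speed [|p|] of the first component and the bound [M + 1 + delta] on
     the second; the last [1] makes it positive. *)
  have [|N hN] := tg (e / (`|p| + M + 1 + delta + 1)).
    rewrite divr_gt0 //; have := rM 0%N.
    by have := normr_ge0 (r 0%N); have := normr_ge0 p; lra.
  have K0 : 0 < `|p| + M + 1 + delta + 1.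
    by have := rM 0%N; have := normr_ge0 (r 0%N); have := normr_ge0 p; lra.
  exists N => n /hN; rewrite ler_pdivlMr // => hn.
  have tn := tpos (g n); rewrite prod_norm_le /=; apply/andP; split.
    rewrite opprD addNKr normrN normrZ gtr0_norm //.
    apply: le_trans hn; rewrite ler_pM2l //.
    by have := rM 0%N; have := normr_ge0 (r 0%N); lra.
  rewrite distrC (_ : _ - y = t (g n) *: r (g n)); last first.
    by rewrite scalerA mulfV ?gt_eqF // scale1r.
  rewrite normrZ gtr0_norm //; apply: le_trans hn; rewrite ler_pM2l //.
  by have := rM (g n); have := normr_ge0 p; lra.
- by move=> k; apply: tpos.
- apply/cvgn_distP => e /tg[N hN]; exists N => n /hN.
  by rewrite sub0r normrN /= gtr0_norm.
- apply/cvgn_distP => e e0; have [N hN] := natSinv_le _ e0.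
  exists N => n /hN; rewrite prod_norm_le /=; have [_ hn] := gP n.
  move=> Ne; apply/andP; split; last exact: le_trans hn Ne.
  rewrite (_ : x + _ - x = t (g n) *: p); last by lmodule R.
  rewrite scalerA mulVf ?gt_eqF // scale1r subrr normr0.
  exact: ltW.
Qed.

(** The definition is applied between [x] and [x' = x + t p]: homogeneity gives
    [H (x - x') = t H (- p)]. Dividing [delta] by [c = |p| + 1] absorbs the factor [|p|] of the
    enlargement and stays meaningful for [p = 0]. *)
Lemma selection_of_pseudo_strict {R : realType} {X Y : normedModType R}
    {S H : X -> set Y} {xbar : X} {ybar : Y} (p : X) (delta : R) :
  pos_homogeneous H -> pseudo_strictly_differentiable S H xbar ybar ->
  0 < delta ->
  \forall z \near (xbar, ybar), gph S z -> exists2 t0, 0 < t0 &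
    forall t, 0 < t -> t <= t0 -> exists2 y', S (z.1 + t *: p) y' &
     exists2 h, H (- p) h & `|y' - z.2 + t *: h| <= delta * t.
Proof.
move=> [_ Hph] psd d0; pose c := `|p| + 1.
have c0 : 0 < c by rewrite ltr_wpDl.
have [U [V [/nbhs_ballP[r /= r0 rU] nV UV]]] := psd (delta / c) (divr_gt0 d0 c0).
exists (ball xbar (r / 2), V) => /=.
  by split=> //; apply: nbhsx_ballx; lra.
move=> [x y] /= [xr Vy] Sxy; exists (r / 2 / c); first by rewrite divr_gt0 //; lra.
move=> t t0; rewrite ler_pdivlMr // => tc.
have tp : t * `|p| <= r / 2 by apply: le_trans tc; rewrite ler_pM2l // lerDl.
have Ux : U x by apply: rU; apply: le_ball xr; lra.
have Ux' : U (x + t *: p).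
  apply: rU; move: xr; rewrite -!ball_normE /= => xr.
  rewrite opprD addrA; apply: le_lt_trans (ler_normB _ _) _.
  by rewrite normrZ gtr0_norm //; lra.
have [y' Sy' [w [h' Hh' [e he <-]] yE]] := UV _ _ Ux Ux' y (conj Sxy Vy).
exists y' => //; move: Hh'.
rewrite opprD addNKr -scalerN Hph // => -[h Hh h'E]; exists h => //.
have -> : y' - y + t *: h = - e by rewrite -yE -h'E; lmodule R.
move: he; rewrite /closed_ball_ /= sub0r opprD addNKr !normrN normrZ gtr0_norm //.
move=> /le_trans; apply.
rewrite (_ : _ * (t * _) = delta * t * (`|p| / c)); last by ring.
by rewrite ger_pMr ?mulr_gt0 // ler_pdivrMr // mul1r lerDl.
Qed.

(** Precision [1/(n+1)] at late points of [s] yields tangent vectors [(p, q_n)] and [h_n] in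
    [H (- p)] with [q_n + h_n] tending to [0]. Wherever the [h_n] cluster at [h], the [q_n] cluster
    at [- h]. *)
Lemma pseudo_strict_selection {R : realType} {X Y : normedModType R}
    {S H : X -> set Y} {xbar : X} {ybar : Y} (G : X -> set Y)
    (s : nat -> X * Y) (p : X) :
  finite_dim Y -> compact_valued H -> pos_homogeneous H ->
  (forall j, gph S (s j)) -> s @ \oo --> (xbar, ybar) ->
  outer_limit (fun j => tangent_cone (gph S) (s j)) `<=` gph G ->
  pseudo_strictly_differentiable S H xbar ybar ->
  G p `&` (-%R @` H (- p)) !=set0.
Proof.
move=> fY cH Hph Ss sbar limG psd.
have ex_q (n : nat) : exists jqh : nat * (Y * Y), [/\ (n <= jqh.1)%N,
    tangent_cone (gph S) (s jqh.1) (p, jqh.2.1), H (- p) jqh.2.2 &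
    `|jqh.2.1 + jqh.2.2| <= 2 * n.+1%:R^-1].
  have n0 : 0 < n.+1%:R^-1 :> R by rewrite invr_gt0 ltr0n.
  have [N _ hN] := sbar _ (selection_of_pseudo_strict p _ Hph psd n0).
  have [j nj Nj] : exists2 j, (n <= j)%N & (N <= j)%N.
    by exists (maxn n N); rewrite ?leq_maxl ?leq_maxr.
  have [t0 t00 sel] := hN j Nj (Ss j).
  have [q Tq [h Hh qh]] := tangent_of_selection (s j).1 p (s j).2 _ _ fY
    (cH (- p)) (Ss j) n0 t00 sel.
  by exists (j, (q, h)); rewrite -surjective_pairing in Tq.
have [f fP] := choice ex_q.
have fH n : H (- p) (f n).2.2 by case: (fP n).
have [h Hh hP] := compact_cluster_seq _ (fun n => (f n).2.2) (cH (- p)) fH.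
exists (- h); split; last by exists h.
apply: (limG (p, - h)); apply: outer_limit_frequently => e N e0.
have [N1 hN1] := natSinv_le (e / 4) ltac:(lra).
have [n nN hn] := hP (e / 2) (maxn N N1) ltac:(lra).
move: nN; rewrite geq_max => /andP[Nn /hN1 n1e].
have [nj Tn _ qh] := fP n.
exists (f n).1; first exact: leq_trans nj.
exists (p, (f n).2.1) => //; rewrite prod_norm_le /= subrr normr0 (ltW e0) /=.
rewrite (_ : - h - _ = - (h - (f n).2.2) - ((f n).2.1 + (f n).2.2)).
  apply: le_trans (ler_normB _ _) _; rewrite normrN.
  by move: qh n1e; set a := n.+1%:R^-1; lra.
by lmodule R.
Qed.

(** * Approximate moves, and how they are glued into pseudo strict differentiability *)

(** Motion from [z] to [z'] during time [t] with velocity [(p, - h)]. The signs come from the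
    inclusion of [y] in [y' + H (x - x')], where [x - x' = - t p]. *)
Definition approx_move {R : realType} {X Y : normedModType R} (H : X -> set Y)
    (eps t : R) (p : X) (z z' : X * Y) : Prop :=
  `|z'.1 - z.1 - t *: p| <= eps * t /\
  exists2 h, H (- p) h & `|z'.2 - z.2 + t *: h| <= eps * t.

(** The neighborhood depends on [eps] alone and serves all unit directions [p]. The durations are
    arbitrarily short but not prescribed, so moves of a given length have to be obtained by
    gluing. *)
Definition approx_tangent {R : realType} {X Y : normedModType R}
    (S H : X -> set Y) (zbar : X * Y) : Prop :=
  forall eps : R, 0 < eps -> \forall z \near zbar, gph S z ->
    forall (p : X) (t0 : R), `|p| = 1 -> 0 < t0 ->
      exists (t : R) z', [/\ 0 < t, t <= t0, gph S z' & approx_move H eps t p z z'].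

Lemma outer_norm_bound {R : realType} {X Y : normedModType R}
    (H : X -> set Y) : outer_norm H \is a fin_num ->
  exists2 M : R, 0 <= M & forall w h, `|w| <= 1 -> H w h -> `|h| <= M.
Proof.
move=> fH; exists `|fine (outer_norm H)| => // w h w1 Hh.
suff : (`|h|%:E <= outer_norm H)%E.
  by rewrite -(fineK fH) lee_fin => /le_trans; apply; exact: ler_norm.
apply: (@le_trans _ _ (ereal_sup [set `|z|%:E | z in H w])).
  by apply: ereal_sup_ubound; exists h.
by apply: ereal_sup_ubound; exists w => //; rewrite /closed_ball_ /= sub0r normrN.
Qed.

(** In the max norm the two components move at speeds at most [1 + eps] and [M + eps], both at most
    [M + 2]. *)
Lemma approx_move_dist {R : realType} {X Y : normedModType R}
    (H : X -> set Y) (eps t M : R) (p : X) (z z' : X * Y) :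
  (forall h, H (- p) h -> `|h| <= M) -> `|p| = 1 -> eps <= 1 -> 0 <= t ->
  0 <= M -> approx_move H eps t p z z' -> `|z' - z| <= (M + 2) * t.
Proof.
move=> HM p1 e1 t0 M0 [h1 [h Hh h2]].
have et : eps * t <= t by rewrite ler_piMl.
have Mt : 0 <= M * t by rewrite mulr_ge0.
rewrite prod_norm_le /=; apply/andP; split.
  have -> : z'.1 - z.1 = (z'.1 - z.1 - t *: p) + t *: p by rewrite subrK.
  apply: le_trans (ler_normD _ _) _.
  by rewrite normrZ p1 ger0_norm //; lra.
have -> : z'.2 - z.2 = (z'.2 - z.2 + t *: h) - t *: h by rewrite addrK.
apply: le_trans (ler_normB _ _) _; rewrite normrZ ger0_norm //.
have : t * `|h| <= t * M by rewrite ler_wpM2l // HM.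
lra.
Qed.

Lemma closed_cvgn {R : realType} {V : normedModType R} (D : set V)
    (u : nat -> V) (l : V) (N : nat) :
  closed D -> (forall n, (N <= n)%N -> D (u n)) -> u @ \oo --> l -> D l.
Proof. by move=> cD Du; apply: closed_cvg => //; exists N. Qed.

(* Following a fixed direction: [phi (t, z) = t] is maximised over the chains
   of approximate moves, which live in the product of time and space. *)
Lemma approx_move_extend {R : realType} {X Y : normedModType R}
    (H : X -> set Y) (D : set (X * Y)) (z0 : X * Y) (p : X)
    (r eps M tE : R) :
  seq_complete X -> seq_complete Y -> closed D ->
  @convex_set R Y (H (- p)) -> (forall h, H (- p) h -> `|h| <= M) ->
  0 <= M -> `|p| = 1 -> 0 < eps -> eps <= 1 -> D z0 -> 0 < tE ->
  (M + 2) * tE < r ->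
  (forall z t0, D z -> `|z - z0| < r -> 0 < t0 -> exists (t : R) z',
     [/\ 0 < t, t <= t0, D z' & approx_move H eps t p z z']) ->
  exists z', [/\ D z', `|z' - z0| <= (M + 2) * tE &
                 approx_move H (2 * eps) tE p z0 z'].
Proof.
move=> cX cY cD cH HM M0 p1 e0 e1 Dz0 tE0 tEr step.
pose E := (R * (X * Y))%type.
have cE : seq_complete E.
  apply: seq_complete_prod; first exact: completeNormedMod_seq_complete.
  exact: seq_complete_prod.
pose w (s : E) : X := s.2.1 - s.1 *: p.
(* The first two clauses are implications so that the relation is reflexive on all of [E]. The slack
   [e] lets the last clause survive limits: the velocities [h] of the approximants may have no limit
   inside [H (- p)]. *)
pose le (s s' : E) := [/\ s.1 <= tE -> s'.1 <= tE, D s.2 -> D s'.2,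
  `|w s' - w s| <= eps * (s'.1 - s.1) &
  forall e : R, 0 < e -> exists2 h, H (- p) h &
    `|s'.2.2 - s.2.2 + (s'.1 - s.1) *: h| <= eps * (s'.1 - s.1) + e].
have le_time s s' : le s s' -> s.1 <= s'.1.
  case=> _ _ h _; rewrite -subr_ge0 -(pmulr_rge0 _ e0).
  exact: le_trans h.
(* Reflexivity requires some element of [H (- p)]; the first move from [z0] provides it. *)
have [h0 Hh0] : exists h, H (- p) h.
  have := tEr; have tM : 0 <= (M + 2) * tE by apply: mulr_ge0; lra.
  have [|||t [z' [_ _ _ [_ [h Hh _]]]]] := step z0 1 => //; last by exists h.
  by rewrite subrr normr0; lra.
have le_refl s : le s s.
  split=> //; first by rewrite !subrr normr0 mulr0.
  move=> e ee; exists h0 => //.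
  by rewrite !subrr scale0r addr0 normr0 mulr0 add0r ltW.
have le_tr s1 s2 s3 : le s1 s2 -> le s2 s3 -> le s1 s3.
  move=> l12 l23; have t12 := le_time _ _ l12; have t23 := le_time _ _ l23.
  case: l12 => [a1 b1 c1 d1]; case: l23 => [a2 b2 c2 d2]; split.
  - by move=> /a1/a2.
  - by move=> /b1/b2.
  - by have := ler_distD (w s2) (w s3) (w s1); lra.
  - move=> e ee; have [h1 Hh1 k1] := d1 (e / 2) ltac:(lra).
    have [h2 Hh2 k2] := d2 (e / 2) ltac:(lra).
    set a : R := s2.1 - s1.1 in c1 k1 *; set b : R := s3.1 - s2.1 in c2 k2 *.
    have a0 : 0 <= a by rewrite subr_ge0.
    have b0 : 0 <= b by rewrite subr_ge0.
    have abE : s3.1 - s1.1 = a + b by rewrite /a /b; lra.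
    (* Convexity merges two successive velocities into their mean weighted by duration; a zero total
       duration is treated apart. *)
    have [h Hh hE] : exists2 h, H (- p) h & (a + b) *: h = a *: h1 + b *: h2.
      have [ab0|abn0] := eqVneq (a + b) 0.
        exists h1 => //; have -> : a = 0 by lra.
        have -> : b = 0 by lra.
        by rewrite addr0 !scale0r addr0.
      exists ((a / (a + b)) *: h1 + (b / (a + b)) *: h2).
        apply: convex_set_comb => //; try by apply: divr_ge0 => //; exact: addr_ge0.
        by rewrite -mulrDl divff.
      by rewrite scalerDr !scalerA !(mulrC (a + b)) !divfK.
    exists h => //; rewrite abE hE.
    rewrite (_ : _ + (a *: h1 + b *: h2) = (s2.2.2 - s1.2.2 + a *: h1) +
      (s3.2.2 - s2.2.2 + b *: h2)); last by lmodule R.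
    by apply: le_trans (ler_normD _ _) _; lra.
have le_move s s' : le s s' -> `|s'.2.1 - s.2.1| <= (M + 2) * (s'.1 - s.1) /\
    `|s'.2.2 - s.2.2| <= (M + 2) * (s'.1 - s.1).
  move=> ss'; have : 0 <= s'.1 - s.1 by rewrite subr_ge0 le_time.
  case: ss' => _ _; set a : R := s'.1 - s.1 => h1 h2 a0.
  have ea : eps * a <= a by rewrite ler_piMl.
  have Ma : 0 <= M * a by rewrite mulr_ge0.
  split.
    have -> : s'.2.1 - s.2.1 = (w s' - w s) + a *: p.
      by rewrite /w /a; lmodule R.
    apply: le_trans (ler_normD _ _) _; rewrite normrZ p1 ger0_norm //; lra.
  apply/ler_addgt0Pr => e /h2[h Hh k].
  have -> : s'.2.2 - s.2.2 = (s'.2.2 - s.2.2 + a *: h) - a *: h by rewrite addrK.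
  apply: le_trans (ler_normB _ _) _; rewrite normrZ ger0_norm //.
  have : a * `|h| <= a * M by rewrite ler_wpM2l // HM.
  by lra.
have le_dist s s' : le s s' -> `|s' - s| <= (M + 2) * (s'.1 - s.1).
  move=> ss'; have := le_time _ _ ss'; have [h1 h2] := le_move _ _ ss'.
  rewrite !prod_norm_le /= h1 h2 /= andbT -subr_ge0 => a0.
  rewrite ger0_norm //.
  by have := mulr_ge0 M0 a0; move: a0; set a : R := s'.1 - s.1; lra.
have le_lim (u : nat -> E) (l : E) :
    (forall n m, (n <= m)%N -> le (u n) (u m)) -> u @ \oo --> l ->
    forall n, le (u n) l.
  move=> ule ul n.
  have app (e : R) : 0 < e -> exists2 m, (n <= m)%N &
      [/\ `|l.1 - (u m).1| <= e, `|l.2.1 - (u m).2.1| <= e &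
          `|l.2.2 - (u m).2.2| <= e].
    move=> ee; have [N hN] := (cvgn_distP _ _).1 ul _ ee.
    exists (maxn n N); first exact: leq_maxl.
    have := hN (maxn n N) (leq_maxr _ _).
    by rewrite !prod_norm_le /= => /and3P[].
  split.
  - move=> utE; rewrite leNgt; apply/negP => tEl.
    have [m nm [h _ _]] := app ((l.1 - tE) / 2) ltac:(lra).
    have [/(_ utE) umtE _ _ _] := ule _ _ nm.
    by move: h; rewrite ler_norml => /andP[]; lra.
  - move=> Dun.
    apply: (@closed_cvgn _ _ D (fun m => (u m).2) l.2 n cD).
      by move=> m nm; have [_ /(_ Dun)] := ule _ _ nm.
    apply/cvgn_distP => e /((cvgn_distP _ _).1 ul)[N hN]; exists N => m /hN.
    by rewrite prod_norm_le /= => /andP[].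
  - apply/ler_addgt0Pr => e ee.
    have [m nm [k1 k2 _]] := app (e / 3) ltac:(lra).
    have [_ _ h _] := ule _ _ nm.
    have := ler_distD (w (u m)) (w l) (w (u n)).
    have wE : w l - w (u m) = (l.2.1 - (u m).2.1) - (l.1 - (u m).1) *: p.
      by rewrite /w; lmodule R.
    have := ler_normB (l.2.1 - (u m).2.1) ((l.1 - (u m).1) *: p).
    rewrite -wE normrZ p1.
    have k3 : eps * ((u m).1 - (u n).1) <= eps * (l.1 - (u n).1) + e / 3.
      have : eps * ((u m).1 - l.1) <= 1 * (e / 3); last by lra.
      have k4 : (u m).1 - l.1 <= e / 3.
        by move: k1; rewrite ler_norml => /andP[]; lra.
      apply: le_trans (ler_wpM2l (ltW e0) k4) _.
      by apply: ler_wpM2r => //; lra.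
    by lra.
  - move=> e ee; have K0 : 0 < M + 3 by lra.
    (* With [d] this precision, the errors in position, in elapsed time multiplied by [h], and in
       the bound itself are at most [d], [d * M] and [d], which fits into [e / 2]. *)
    have d0 : 0 < e / 2 / (M + 3) by rewrite !divr_gt0.
    have [m nm [k1 _ k2]] := app _ d0.
    have [_ _ _ /(_ (e / 2) ltac:(lra))[h Hh k3]] := ule _ _ nm.
    exists h => //.
    rewrite (_ : _ + _ = (l.2.2 - (u m).2.2) + ((u m).2.2 - (u n).2.2 +
      ((u m).1 - (u n).1) *: h) + (l.1 - (u m).1) *: h); last by lmodule R.
    apply: le_trans (ler_normD _ _) _; rewrite normrZ.
    have := ler_normD (l.2.2 - (u m).2.2)
      ((u m).2.2 - (u n).2.2 + ((u m).1 - (u n).1) *: h).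
    move: d0 k1 k2; set d := _ / _ => d0 k1 k2.
    have dE : d * (M + 3) = e / 2 by rewrite /d divfK // gt_eqF.
    have : `|l.1 - (u m).1| * `|h| <= d * M.
      by apply: ler_pM => //; apply: HM.
    have : eps * ((u m).1 - l.1) <= 1 * d.
      have k4 : (u m).1 - l.1 <= d.
        by move: k1; rewrite ler_norml => /andP[]; lra.
      apply: le_trans (ler_wpM2l (ltW e0) k4) _.
      by apply: ler_wpM2r => //; lra.
    by lra.
have le0 (y : E) : le (0, z0) y -> y.1 <= tE by case=> + _ _ _; apply; exact: ltW.
have [|s lz smax] := @maximal_element _ _ le (fun s : E => s.1) (M + 2)
   tE (0, z0) cE _ le_refl le_tr le_dist le0 le_lim; first by lra.
have [t [z sE]] : exists (t : R) (z : X * Y), s = (t, z).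
  by exists s.1, s.2; case: s {lz smax}.
subst s; have ttE : t <= tE := le0 _ lz.
have t0 : 0 <= t := le_time _ _ lz.
have [_ /(_ Dz0) /= Dz _ _] := lz.
have dz : `|z - z0| <= (M + 2) * t.
  by have [] := le_move _ _ lz; rewrite prod_norm_le /= subr0 => -> ->.
(* If the maximal time were below [tE], one more move of duration at most [tE - t] would extend the
   chain. *)
have tEt : tE <= t.
  rewrite leNgt; apply/negP => tltE.
  have [||t' [z' [t'0 t'le Dz' [m1 [h Hh m2]]]]] := step z (tE - t) Dz.
  - apply: le_lt_trans dz _; apply: le_lt_trans tEr.
    by apply: ler_wpM2l; [lra|exact: ltW].
  - by rewrite subr_gt0.
  suff ltt : le (t, z) (t + t', z').
    by have : t + t' <= t := smax _ ltt; lra.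
  split=> //=; first by move=> _; lra.
  - rewrite /w /= (_ : _ - _ = z'.1 - z.1 - t' *: p); last by lmodule R.
    by have -> : t + t' - t = t' by lra.
  - move=> e ee; exists h => //; have -> : t + t' - t = t' by lra.
    by apply: le_trans m2 _; rewrite lerDl ltW.
have tE' : t = tE by lra.
subst t; case: lz => _ _ /= k1 k2; exists z; split => //; split.
  move: k1; rewrite /w /= subr0 scale0r subr0 => k1.
  rewrite (_ : _ - _ = z.1 - tE *: p - z0.1); last by lmodule R.
  by apply: le_trans k1 _; have := mulr_gt0 e0 tE0; lra.
(* Taking the slack equal to [eps * tE] produces the factor [2] in the conclusion. *)
have [h Hh] := k2 (eps * tE) (mulr_gt0 e0 tE0); rewrite subr0 => k3.
by exists h => //; apply: le_trans k3 _; lra.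
Qed.

(** The maximality principle is applied to minus the horizontal distance to [x']. The bound
    [k * |x' - z0.1| < r] keeps the maximal point in the region where a step is available, so it
    must lie over [x']. *)
Lemma graph_point_over {R : realType} {X Y : normedModType R}
    (D : set (X * Y)) (z0 : X * Y) (x' : X) (r k : R) :
  seq_complete X -> seq_complete Y -> closed D -> D z0 -> 0 < k ->
  k * `|x' - z0.1| < r ->
  (forall z, D z -> `|z - z0| < r -> z.1 != x' -> exists z',
     [/\ D z', `|x' - z'.1| < `|x' - z.1| &
         `|z' - z| <= k * (`|x' - z.1| - `|x' - z'.1|)]) ->
  exists2 y', D (x', y') & `|y' - z0.2| <= k * `|x' - z0.1|.
Proof.
move=> cX cY cD Dz0 k0 kr step.
pose f (z : X * Y) := `|x' - z.1|.
pose le (z z' : X * Y) := (D z -> D z') /\ `|z' - z| <= k * (f z - f z').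
have le_refl z : le z z by split=> //; rewrite !subrr normr0 mulr0.
have le_tr z1 z2 z3 : le z1 z2 -> le z2 z3 -> le z1 z3.
  move=> [a1 b1] [a2 b2]; split; first by move=> /a1/a2.
  by have := ler_distD z2 z3 z1; lra.
have le_dist z z' : le z z' -> `|z' - z| <= k * (- f z' - - f z).
  by move=> [_]; rewrite opprK (addrC (- f z')).
have le0 y : le z0 y -> - f y <= 0 by move=> _; rewrite oppr_le0 /f.
have le_lim (u : nat -> X * Y) l :
    (forall n m, (n <= m)%N -> le (u n) (u m)) -> u @ \oo --> l ->
    forall n, le (u n) l.
  move=> ule ul n; split.
    by move=> Dun; apply: (closed_cvgn D u l n cD) => // m /ule[/(_ Dun)].
  apply/ler_addgt0Pr => e ee.
  have d0 : 0 < e / (k + 1) by rewrite divr_gt0 //; lra.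
  have [N hN] := (cvgn_distP _ _).1 ul _ d0.
  have lm := hN (maxn n N) (leq_maxr _ _).
  have [_ um] := ule _ _ (leq_maxl n N).
  move: lm um d0; set m := maxn n N; set d := e / _ => lm um d0.
  have dE : d * (k + 1) = e by rewrite /d divfK // gt_eqF //; lra.
  have fm : f l <= f (u m) + d.
    have := ler_distD (u m).1 x' l.1; rewrite -/(f l) -/(f _).
    move: lm; rewrite prod_norm_le => /andP[+ _].
    by rewrite distrC /=; lra.
  have : k * (f (u n) - f (u m)) <= k * (f (u n) - f l + d).
    by rewrite ler_pM2l //; lra.
  by have := ler_distD (u m) l (u n); lra.
have [z [/(_ Dz0) Dz dz] zmax] := @maximal_element _ _ le (fun z => - f z) k 0
  z0 (seq_complete_prod _ _ cX cY) k0 le_refl le_tr le_dist le0 le_lim.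
have dz' : `|z - z0| <= k * f z0.
  apply: le_trans dz _; rewrite ler_pM2l //.
  by have := normr_ge0 (x' - z.1); rewrite -/(f z); lra.
have zx : z.1 = x'.
  apply/eqP/negPn/negP => zx.
  have [|z' [Dz' ltz' dz'']] := step z Dz _ zx.
    exact: le_lt_trans dz' kr.
  by have := zmax z' (conj (fun=> Dz') dz''); rewrite lerN2 leNgt /f ltz'.
exists z.2; first by rewrite -zx -surjective_pairing.
by move: dz'; rewrite prod_norm_le => /andP[].
Qed.

Lemma norm2_le {R : realType} {X Y : normedModType R} (z : X * Y) :
  norm2 z <= 2 * `|z|.
Proof.
have [h1 h2] : `|z.1| <= `|z| /\ `|z.2| <= `|z|.
  by apply/andP; rewrite -prod_norm_le.
apply: (@le_trans _ _ (`|z.1| + `|z.2|)); last by lra.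
rewrite /norm2 -[leRHS]ger0_norm ?addr_ge0 // -sqrtr_sqr ler_wsqrtr //.
by rewrite sqrrD lerD2r lerDl mulrn_wge0 // mulr_ge0.
Qed.

(** A max-norm ball of radius at most [e / 2] is contained in the [norm2] ball of radius [e], so
    local closedness can be used in the canonical norm of the product. *)
Lemma locally_closed_prod_norm {R : realType} {X Y : normedModType R}
    (S : X -> set Y) (zbar : X * Y) :
  locally_closed_at S zbar ->
  exists2 e : R, 0 < e & forall r, 0 < r -> r <= e ->
    closed (gph S `&` [set z | `|zbar - z| <= r]).
Proof.
move=> [e e0 cle]; exists (e / 2) => [|r r0 re]; first by lra.
rewrite (_ : _ `&` _ = (gph S `&` closed_ball_ (@norm2 R X Y) zbar e) `&`
  [set z | `|zbar - z| <= r]).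
  apply: closedI => //.
  have -> : [set z | `|zbar - z| <= r] = closed_ball zbar r.
    by rewrite closed_ballE.
  exact: closed_ball_closed.
apply/seteqP; split=> z /=; last by move=> [[? _] ?].
move=> [Sz zr]; do 2!split=> //.
by apply: le_trans (norm2_le _) _; lra.
Qed.

Lemma approx_tangent_pseudo_strict {R : realType} {X Y : normedModType R}
    (S H : X -> set Y) (xbar : X) (ybar : Y) :
  seq_complete X -> seq_complete Y -> locally_closed_at S (xbar, ybar) ->
  pos_homogeneous H -> outer_norm H \is a fin_num -> convex_valued H ->
  approx_tangent S H (xbar, ybar) ->
  pseudo_strictly_differentiable S H xbar ybar.
Proof.
move=> cX cY /locally_closed_prod_norm[e e0 cle] [H0 Hph] fH cH stp delta d0.
have [M M0 HM] := outer_norm_bound _ fH.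
(* [L] bounds the speed of a move. As [eps <= 1/2], a move heading for [x'] gains at least half its
   duration, whence the ratio [k = 2 L]. The vertical error is [2 eps t] in the first stage and
   [k * 2 eps t] in the second, hence the condition [eps * (2 + 2 k) <= delta]. *)
pose L := M + 2; pose k := 2 * L.
pose eps := Num.min (1 / 2) (delta / (2 + 2 * k)).
have K0 : 0 < 2 + 2 * k by rewrite /k /L; lra.
have eps0 : 0 < eps by rewrite lt_min; apply/andP; split; [lra|exact: divr_gt0].
have eps1 : eps <= 1 / 2 by rewrite ge_min lexx.
have epsd : eps * (2 + 2 * k) <= delta by rewrite -ler_pdivlMr // ge_min lexx orbT.
set zbar := (xbar, ybar) in cle stp *.
have /nbhs_ballP[r1 /= r10 r1P] := stp _ eps0.
pose r := Num.min (r1 / 2) (e / 2).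
have r0 : 0 < r by rewrite lt_min; apply/andP; split; lra.
have rr1 : r <= r1 / 2 by rewrite ge_min lexx.
have re : r <= e / 2 by rewrite ge_min lexx orbT.
pose D := gph S `&` [set z | `|zbar - z| <= r].
have cD : closed D by apply: cle; lra.
have Dstep z p t0 : D z -> `|zbar - z| < r -> `|p| = 1 -> 0 < t0 ->
    exists (t : R) z', [/\ 0 < t, t <= t0, D z' & approx_move H eps t p z z'].
  move=> [Sz _] zr p1 t00.
  (* Capping the duration by the distance left to the boundary, divided by the speed [L], keeps the
     move inside [D]. *)
  pose t1 := Num.min t0 ((r - `|zbar - z|) / L).
  have L0 : 0 < L by rewrite /L; lra.
  have t10 : 0 < t1 by rewrite lt_min t00 divr_gt0 // subr_gt0.
  have [|t [z' [tp tt1 Sz' mz]]] := r1P z _ Sz p t1 p1 t10.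
    by rewrite -ball_normE /=; lra.
  move: tt1; rewrite le_min => /andP[tt0 tr].
  exists t, z'; split => //; split => //=.
  have dz : `|z' - z| <= L * t.
    apply: (approx_move_dist H eps t M p) => //; [|lra|exact: ltW].
    by move=> h; apply: HM; rewrite normrN p1.
  have := ler_distD z zbar z'; rewrite (distrC z z').
  by move: tr; rewrite ler_pdivlMr //; lra.
have L0 : 0 < L by rewrite /L; lra.
(* Budget: the start is within [rho] of [zbar], the first stage covers at most [L t <= 2 L rho], the
   second at most [2 L t <= 4 L rho], and one [rho] is left over. *)
pose rho := r / (2 + 6 * L).
have rhoE : rho * (2 + 6 * L) = r by rewrite /rho divfK // gt_eqF //; lra.
have rho0 : 0 < rho by rewrite divr_gt0 //; lra.
have Lrho : 0 < L * rho by rewrite mulr_gt0.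
exists (ball xbar rho), (ball ybar rho).
split; [exact: nbhsx_ballx|exact: nbhsx_ballx|].
move=> x x' Ux Ux' y [Sxy Vy].
move: Ux Ux' Vy; rewrite -!ball_normE /= => Ux Ux' Vy.
have [<-|xx'] := eqVneq x x'.
  exists y => //; exists 0; rewrite ?addr0 // subrr.
  exists 0 => //; exists 0; rewrite ?addr0 //.
  by rewrite /closed_ball_ /= subrr !normr0 mulr0.
pose t := `|x' - x|.
have t0 : 0 < t by rewrite normr_gt0 subr_eq0 eq_sym.
have t2 : t < 2 * rho.
  by have := ler_distD xbar x' x; rewrite (distrC x' xbar) -/t; lra.
have Lt : L * t <= 2 * (L * rho) by rewrite mulrCA ler_pM2l // ltW.
pose p := t^-1 *: (x' - x).
have p1 : `|p| = 1.
  by rewrite normrZ gtr0_norm ?invr_gt0 // mulVf // gt_eqF.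
have tp : t *: p = x' - x by rewrite scalerA mulfV ?gt_eqF // scale1r.
have zz0 : `|zbar - (x, y)| <= rho.
  by rewrite prod_norm_le /=; apply/andP; split; exact: ltW.
have Dz0 : D (x, y) by split=> //=; lra.
(* First stage: the fixed direction [p] is followed for the whole time [t], up to a point [z1] whose
   abscissa is within [2 eps t] of [x']. *)
have [||||z1 [Dz1 z10 [m1 [h Hh m2]]]] := approx_move_extend H D (x, y) p (r - rho)
    eps M t cX cY cD (cH (- p)) _ M0 p1 eps0 _ Dz0 t0.
- by move=> h; apply: HM; rewrite normrN p1.
- by lra.
- by rewrite -/L; lra.
- move=> z t1 Dz zz1 t10; apply: Dstep => //.
  by have := ler_distD (x, y) zbar z; rewrite (distrC (x, y) z); lra.
move: m1 m2; rewrite /= tp => m1 m2.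
have xz1 : `|x' - z1.1| <= 2 * eps * t.
  by rewrite distrC (_ : _ - _ = z1.1 - x - (x' - x)) //; lmodule R.
have et : 2 * eps * t <= t by rewrite ler_piMl //; lra.
have kt : k * `|x' - z1.1| <= k * (2 * eps * t) by rewrite ler_pM2l // /k; lra.
have ket : k * (2 * eps * t) <= 2 * (L * t).
  by rewrite /k mulrA ler_pM2l ?mulr_gt0 // ; lra.
(* Second stage: from [z1] to a point over [x'] itself, each move being aimed at [x'] from the
   current position. *)
have [|||y' [Sy' _] y'z] := graph_point_over D z1 x' (r - rho - L * t) k cX cY cD
    Dz1; first by rewrite /k; lra.
- by lra.
- move=> z Dz zz1 zx'; pose a := `|x' - z.1|.
  have a0 : 0 < a by rewrite normr_gt0 subr_eq0 eq_sym.
  pose p' := a^-1 *: (x' - z.1).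
  have p'1 : `|p'| = 1.
    by rewrite normrZ gtr0_norm ?invr_gt0 // mulVf // gt_eqF.
  have ap' : a *: p' = x' - z.1 by rewrite scalerA mulfV ?gt_eqF // scale1r.
  have [|t' [z' [t'0 t'a Dz' mv]]] := Dstep z p' a Dz _ p'1 a0.
    have := ler_distD (x, y) zbar z; have := ler_distD z1 z (x, y).
    by rewrite (distrC (x, y) z) -/L in z10 *; lra.
  have dz : `|z' - z| <= L * t'.
    apply: (approx_move_dist H eps t' M p') => //; [|lra|exact: ltW].
    by move=> h'; apply: HM; rewrite normrN p'1.
  have [m3 _] := mv.
  have et' : eps * t' <= 1 / 2 * t' by rewrite ler_pM2r.
  (* Since [t' <= a], the ideal move does not overshoot [x'], so the distance drops by at least
     [(1 - eps) t']. *)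
  have dec : `|x' - z'.1| <= a - t' + eps * t'.
    have -> : x' - z'.1 = (a - t') *: p' - (z'.1 - z.1 - t' *: p').
      by rewrite scalerBl ap'; lmodule R.
    apply: le_trans (ler_normB _ _) _.
    by rewrite normrZ p'1 mulr1 ger0_norm ?subr_ge0 // lerD2l.
  exists z'; split=> //; first by rewrite -/a; lra.
  apply: le_trans dz _; rewrite /k -mulrA mulrCA ler_pM2l // -/a; lra.
exists y' => //; exists (y - y'); last by rewrite addrC subrK.
exists (t *: h).
  rewrite (_ : x - x' = t *: - p); last by rewrite scalerN tp opprB.
  by rewrite Hph //; exists h.
exists (y - y' - t *: h); last by rewrite addrC subrK.
rewrite /closed_ball_ /= sub0r normrN (distrC x x') -/t.
have -> : y - y' - t *: h = - (z1.2 - y + t *: h) - (y' - z1.2) by lmodule R.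
apply: le_trans (ler_normB _ _) _; rewrite normrN.
have : eps * (2 + 2 * k) * t <= delta * t by rewrite ler_pM2r.
lra.
Qed.

(** * From inner semicontinuity of the tangent cone to approximate moves *)

Lemma norm2_ge {R : realType} {X Y : normedModType R} (z : X * Y) :
  `|z| <= norm2 z.
Proof.
have h (u v : R) : 0 <= u -> u <= Num.sqrt (u ^+ 2 + v ^+ 2).
  move=> u0; rewrite -{1}(ger0_norm u0) -sqrtr_sqr ler_wsqrtr //.
  by rewrite lerDl sqr_ge0.
by rewrite prod_norm_le /norm2 h //= addrC h.
Qed.

Lemma norm2_ge0 {R : realType} {X Y : normedModType R} (z : X * Y) :
  0 <= norm2 z.
Proof. exact: sqrtr_ge0. Qed.

(* The direction [(p, -h)] is the element of [gph (G i)] given by the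
   intersection condition. *)
Lemma isc_direction {R : realType} {X Y : normedModType R}
    {S : X -> set Y} {H : X -> set Y} {I : Type} {G : I -> X -> set Y}
    {zbar : X * Y} {T : X * Y -> set (X * Y)} {M : R} (eps : R) :
  (forall w h, `|w| <= 1 -> H w h -> `|h| <= M) -> 0 <= M ->
  family_isc (@norm2 R X Y) (fun i => gph (G i)) (gph S) T zbar ->
  (forall (p : X) (i : I), p != 0 -> G i p `&` (-%R @` H (- p)) !=set0) ->
  0 < eps ->
  \forall z \near zbar, gph S z -> forall p : X, `|p| = 1 ->
    exists h w, [/\ H (- p) h, T z w & norm2 ((p, - h) - w) <= eps].
Proof.
move=> HM M0 [_ isc] inter eps0.
(* This radius contains every [(p, - h)] with [|p| = 1] and [h] in [H (- p)]; the factor [2] is the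
   price of passing from the max norm to [norm2]. *)
have rho0 : 0 < 2 * (1 + M) by lra.
have [V nV VP] := isc _ _ rho0 eps0.
apply: filterS nV => z Vz Sz p p1.
have [i iP] := VP z (conj Sz Vz).
have p0 : p != 0 by rewrite -normr_eq0 p1 oner_neq0.
have [q [Gq [h Hh hq]]] := inter p i p0.
have [|w Tw [e' he' wE]] := iP (p, q).
  split; first exact: Gq.
  rewrite /closed_ball_ /= sub0r; apply: le_trans (norm2_le _) _.
  rewrite normrN ler_pM2l // prod_norm_le /= p1 -hq normrN.
  have := HM (- p) h; rewrite normrN p1 => /(_ (lexx _) Hh).
  by move=> hM; apply/andP; split; lra.
exists h, w; split => //; rewrite hq -wE addrC addKr.
move: he'; rewrite /closed_ball_ /= sub0r /norm2 /=.
by rewrite !normrN.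
Qed.

(** Half of [eps] pays for replacing [(p, - h)] by a tangent vector [w], the other half for
    replacing [w] by a difference quotient of graph points with small [ts n]. *)
Lemma isc_approx_tangent {R : realType} {X Y : normedModType R}
    (S H : X -> set Y) (I : Type) (G : I -> X -> set Y) (zbar : X * Y) :
  outer_norm H \is a fin_num ->
  family_isc (@norm2 R X Y) (fun i => gph (G i)) (gph S)
    (tangent_cone (gph S)) zbar ->
  (forall (p : X) (i : I), p != 0 -> G i p `&` (-%R @` H (- p)) !=set0) ->
  approx_tangent S H zbar.
Proof.
move=> fH isc inter eps eps0; have [M M0 HM] := outer_norm_bound _ fH.
have eps20 : 0 < eps / 2 by lra.
apply: filterS (isc_direction _ HM M0 isc inter eps20) => z zP Sz p t0 p1 t00.
have [h [w [Hh [zs [ts [Szs _ ts0 tsl wl]]] pw]]] := zP Sz p p1.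
have [N1 hN1] := (cvgn_distP _ _).1 tsl _ t00.
have [N2 hN2] := (cvgn_distP _ _).1 wl _ eps20.
have := hN1 (maxn N1 N2) (leq_maxl _ _); have := hN2 (maxn N1 N2) (leq_maxr _ _).
move: (maxn N1 N2) => n wn; rewrite sub0r normrN gtr0_norm // => tn.
exists (ts n), (zs n); split => //.
have := norm2_ge ((p, - h) - w); move: wn.
set v := _ *: (_ - _).
have vE : ts n *: v = zs n - z by rewrite scalerA mulfV ?gt_eqF // scale1r.
move=> wn pw1; have : `|v - (p, - h)| <= eps.
  have := ler_distD w v (p, - h); rewrite (distrC v w) (distrC w (p, - h)); lra.
rewrite prod_norm_le /= opprK => /andP[k1 k2].
have vE1 : ts n *: v.1 = (zs n).1 - z.1 := congr1 fst vE.
have vE2 : ts n *: v.2 = (zs n).2 - z.2 := congr1 snd vE.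
split; last exists h => //.
- by rewrite -vE1 -scalerBr normrZ gtr0_norm // mulrC ler_pM2r.
- by rewrite -vE2 -scalerDr normrZ gtr0_norm // mulrC ler_pM2r.
Qed.

(** * Inner product on the product space, proximal normals and the Euler scheme *)

Definition is_inner_product2 {R : realType} {X Y : normedModType R}
    (ip : X * Y -> X * Y -> R) : Prop :=
  [/\ forall a b c k, ip a (k *: b + c) = k * ip a b + ip a c,
      forall a b, ip a b = ip b a & forall a, ip a a = norm2 a ^+ 2].

Lemma euclidean_prod_inner_product {R : realType} (X Y : normedModType R) :
  euclidean_space X -> euclidean_space Y ->
  exists ip : X * Y -> X * Y -> R, is_inner_product2 ip.
Proof.
move=> [_ [dX hX]] [_ [dY hY]].
exists (fun a b => dX a.1 b.1 + dY a.2 b.2); split => [a b c k|a b|a].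
- by rewrite /= !linearPr /=; ring.
- by rewrite hermC [dY _ _]hermC /= expr0 !mul1r.
- by rewrite /norm2 sqr_sqrtr ?addr_ge0 ?sqr_ge0 // hX hY.
Qed.

Lemma ipD {R : realType} {X Y : normedModType R}
    {ip : X * Y -> X * Y -> R} : is_inner_product2 ip ->
  forall a b c, ip a (b + c) = ip a b + ip a c.
Proof. by move=> [l _ _] a b c; rewrite -[b]scale1r l mul1r scale1r. Qed.

Lemma ipZ {R : realType} {X Y : normedModType R}
    {ip : X * Y -> X * Y -> R} : is_inner_product2 ip ->
  forall a b k, ip a (k *: b) = k * ip a b.
Proof.
move=> h a b k; have [l _ _] := h.
have ip0 : ip a 0 = 0.
  by have := l a 0 0 1; rewrite scaler0 addr0 mul1r; lra.
by rewrite -[_ *: _]addr0 l ip0 addr0.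
Qed.

Lemma norm2D_sqr {R : realType} {X Y : normedModType R}
    {ip : X * Y -> X * Y -> R} : is_inner_product2 ip ->
  forall a b k, norm2 (a + k *: b) ^+ 2 =
    norm2 a ^+ 2 + 2 * k * ip a b + k ^+ 2 * norm2 b ^+ 2.
Proof.
move=> h a b k; have [_ s n] := h.
rewrite -!n (ipD h) (ipZ h) (s _ a) (s _ b) !(ipD h) !(ipZ h) (s b a).
ring.
Qed.

(** Cauchy-Schwarz, by expanding the square of [a - (norm2 a / norm2 b) b]. *)
Lemma ip_le {R : realType} {X Y : normedModType R}
    {ip : X * Y -> X * Y -> R} : is_inner_product2 ip ->
  forall a b, ip a b <= norm2 a * norm2 b.
Proof.
move=> h a b.
have a0 := norm2_ge0 a; have b0 := norm2_ge0 b.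
have nul c : norm2 c = 0 -> forall d, ip d c = 0.
  move=> c0 d; have /eqP : `|c| = 0.
    by apply/le_anti; rewrite normr_ge0 andbT -c0 norm2_ge.
  by rewrite normr_eq0 => /eqP ->; rewrite -(scale0r 0) (ipZ h) mul0r.
have [an|an] := eqVneq (norm2 a) 0.
  by have [_ s _] := h; rewrite s nul // an mul0r.
have [bn|bn] := eqVneq (norm2 b) 0.
  by rewrite nul // bn mulr0.
have aa : 0 < norm2 a by rewrite lt_def an.
have bb : 0 < norm2 b by rewrite lt_def bn.
have := sqr_ge0 (norm2 (a + (- (norm2 a / norm2 b)) *: b)).
rewrite (norm2D_sqr h).
have -> : (- (norm2 a / norm2 b)) ^+ 2 * norm2 b ^+ 2 = norm2 a ^+ 2.
  by rewrite sqrrN -exprMn divfK.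
move=> k; have : norm2 a / norm2 b * ip a b <= norm2 a ^+ 2 by lra.
by rewrite mulrAC ler_pdivrMr // expr2 -mulrA ler_pM2l.
Qed.

(* At a nearest point [c] to [z], the vector [z - c] is a proximal normal; the
   polar inequality passes from the tangent cone to its closed convex hull. *)
Lemma proximal_normal_clco {R : realType} {X Y : normedModType R}
    {ip : X * Y -> X * Y -> R} (A : set (X * Y)) (z c : X * Y) :
  is_inner_product2 ip ->
  (\forall c' \near c, A c' -> norm2 (z - c) <= norm2 (z - c')) ->
  forall w, clco (tangent_cone A c) w -> ip (z - c) w <= 0.
Proof.
move=> ipP cmin; set a := z - c.
have Na := norm2_ge0 a.
have sub : smallest (@convex_set R (X * Y)%type) (tangent_cone A c) `<=`
    [set w | ip a w <= 0].
  apply: smallest_sub.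
    apply: convex_set_intro => u v k l /= u0 v0 k0 l0 _.
    rewrite (ipD ipP) !(ipZ ipP).
    have := mulr_ge0_le0 k0 u0; have := mulr_ge0_le0 l0 v0; lra.
  move=> w [zs [ts [Azs zsc ts0 _ wl]]] /=.
  apply/ler_addgt0Pr => e e0; rewrite add0r.
  (* The final error is [d * K]: [2 d (|w| + 1)] bounds [ip a v], and [2 d * norm2 a] bounds
     [ip a (w - v)]. *)
  pose K := 2 * `|w| + 2 + 2 * norm2 a.
  have K0 : 0 < K by rewrite /K; have := normr_ge0 w; lra.
  pose d := Num.min 1 (e / K).
  have d0 : 0 < d by rewrite lt_min ltr01 divr_gt0.
  have d1 : d <= 1 by rewrite ge_min lexx.
  have dK : d * K <= e by rewrite -ler_pdivlMr // ge_min lexx orbT.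
  have [N1 _ hN1] := zsc _ cmin.
  have [N2 hN2] := (cvgn_distP _ _).1 zsc _ d0.
  have [N3 hN3] := (cvgn_distP _ _).1 wl _ d0.
  pose n := maxn N1 (maxn N2 N3).
  have n1 : norm2 (z - c) <= norm2 (z - zs n).
    by apply: (hN1 n) => //=; exact: leq_maxl.
  have n2 := hN2 n (leq_trans (leq_maxl _ _) (leq_maxr _ _)).
  have n3 := hN3 n (leq_trans (leq_maxr _ _) (leq_maxr _ _)).
  have tn := ts0 n.
  move: n3; set v := _ *: (_ - _) => n3.
  have vE : ts n *: v = zs n - c by rewrite scalerA mulfV ?gt_eqF // scale1r.
  have zE : z - zs n = a + (- ts n) *: v.
    by rewrite scaleNr vE /a; lmodule R.
  move: n1; rewrite -/a zE => n1.
  have : norm2 a ^+ 2 <= norm2 (a + (- ts n) *: v) ^+ 2.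
    by rewrite lerXn2r ?nnegrE ?norm2_ge0.
  rewrite (norm2D_sqr ipP) sqrrN => q1.
  have q2 : 2 * ip a v <= ts n * norm2 v ^+ 2.
    rewrite -(ler_pM2l tn); rewrite expr2 in q1; lra.
  (* Read as [ip (zs n - c) v], this is the product of a vanishing vector and a bounded one. *)
  have q3 : ts n * norm2 v ^+ 2 <= 2 * d * (2 * (`|w| + 1)).
    have -> : ts n * norm2 v ^+ 2 = ip (zs n - c) v.
      by have [_ s nn] := ipP; rewrite -vE s (ipZ ipP) nn.
    apply: le_trans (ip_le ipP _ _) _; apply: ler_pM; rewrite ?norm2_ge0 //.
      by apply: le_trans (norm2_le _) _; rewrite ler_pM2l // distrC.
    apply: le_trans (norm2_le _) _; rewrite ler_pM2l //.
    have := ler_distD w v 0; rewrite !subr0 (distrC v w); lra.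
  have q4 : ip a (w - v) <= norm2 a * (2 * d).
    apply: le_trans (ip_le ipP _ _) _; apply: ler_wpM2l => //.
    by apply: le_trans (norm2_le _) _; rewrite ler_pM2l.
  have -> : w = v + (w - v) by rewrite addrC subrK.
  rewrite (ipD ipP); move: dK; rewrite /K; lra.
move=> w wcl; apply/ler_addgt0Pr => e e0; rewrite add0r.
have K0 : 0 < 2 * norm2 a + 1 by lra.
have d0 : 0 < e / (2 * norm2 a + 1) by rewrite divr_gt0.
have [v [/sub /= v0]] := wcl _ (nbhsx_ballx w _ d0).
rewrite -ball_normE /= => /ltW; set d := e / _ in d0 * => wv.
have dE : d * (2 * norm2 a + 1) = e by rewrite /d divfK // gt_eqF.
have -> : w = v + (w - v) by rewrite addrC subrK.
rewrite (ipD ipP).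
have : ip a (w - v) <= norm2 a * (2 * d).
  apply: le_trans (ip_le ipP _ _) _; apply: ler_wpM2l => //.
  by apply: le_trans (norm2_le _) _; rewrite ler_pM2l.
lra.
Qed.

(** A minimum of the squared distance [f], whose continuity is immediate, is also one of [norm2]. *)
Lemma compact_nearest {R : realType} {X Y : normedModType R}
    (D : set (X * Y)) (y : X * Y) :
  compact D -> D !=set0 ->
  exists2 c, D c & forall c', D c' -> norm2 (y - c) <= norm2 (y - c').
Proof.
move=> cD D0.
pose f (c : X * Y) : R := `|y.1 - c.1| * `|y.1 - c.1| + `|y.2 - c.2| * `|y.2 - c.2|.
have cf : continuous f.
  move=> c; apply: cvgD; apply: cvgM; apply: cvg_norm; apply: cvgB;
    by [exact: cvg_cst|exact: cvg_fst|exact: cvg_snd].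
have [c /set_mem Dc cmin] := compact_EVT_min D0 cD (continuous_subspaceT cf).
exists c => // c' Dc'; rewrite /norm2 ler_wsqrtr // !expr2 /=.
exact/cmin/mem_set.
Qed.

(* Explicit Euler scheme: by the proximal normal inequality at the nearest
   point, [d^2] grows by at most [2 tau eps d + tau^2 K^2] at each step of size
   [tau], so that after total time [t] the distance to the graph is [O(eps t)]. *)
Lemma isc_clco_approx_tangent {R : realType} {X Y : normedModType R}
    (S H : X -> set Y) (I : Type) (G : I -> X -> set Y) (zbar : X * Y) :
  euclidean_space X -> euclidean_space Y -> gph S zbar ->
  locally_closed_at S zbar -> outer_norm H \is a fin_num -> convex_valued H ->
  family_isc (@norm2 R X Y) (fun i => gph (G i)) (gph S)
    (fun z => clco (tangent_cone (gph S) z)) zbar ->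
  (forall (p : X) (i : I), p != 0 -> G i p `&` (-%R @` H (- p)) !=set0) ->
  approx_tangent S H zbar.
Proof.
move=> eX eY Szb /locally_closed_prod_norm[e e0 cle] fH cH isc inter eps' eps'0.
have [M M0 HM] := outer_norm_bound _ fH.
have [ip ipP] := euclidean_prod_inner_product X Y eX eY.
have [eps eps0 epsE] : exists2 eps : R, 0 < eps & eps' = 3 * eps.
  by exists (eps' / 3); lra.
have /nbhs_ballP[r1 /= r10 r1P] := isc_direction _ HM M0 isc inter eps0.
have [K K0 KE] : exists2 K : R, 0 < K & K = 2 * (1 + M).
  by exists (2 * (1 + M)) => //; lra.
(* A point within [2 r] of [zbar] has its nearest point of [D] within [6 r]. This leaves a margin of
   [r] inside the ball of radius [e], so the point is nearest among all nearby graph points, not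
   only those of [D]. *)
pose r := Num.min (r1 / 8) (e / 8).
have r0 : 0 < r by rewrite lt_min; apply/andP; split; lra.
have rr1 : r <= r1 / 8 by rewrite ge_min lexx.
have re : r <= e / 8 by rewrite ge_min lexx orbT.
pose D := gph S `&` [set z | `|zbar - z| <= e].
have cD : closed D by exact: cle.
have coD : compact D.
  apply: (subclosed_compact cD (compact_setX
    (compact_closed_ball X (`|zbar.1| + e) eX.1)
    (compact_closed_ball Y (`|zbar.2| + e) eY.1))).
  move=> [x y] [_] /=; rewrite prod_norm_le /= => /andP[hx hy]; split => /=.
    by have := ler_distD zbar.1 x 0; rewrite !subr0 (distrC x); lra.
  by have := ler_distD zbar.2 y 0; rewrite !subr0 (distrC y); lra.
have Dzb : D zbar by split=> //=; rewrite subrr normr0 ltW.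
have proj (y : X * Y) : `|zbar - y| <= 2 * r -> exists c, [/\ gph S c, ball zbar r1 c,
    forall c', D c' -> norm2 (y - c) <= norm2 (y - c') &
    \forall c' \near c, gph S c' -> norm2 (y - c) <= norm2 (y - c')].
  move=> yr; have [c [Sc _] cmin] := compact_nearest D y coD (ex_intro _ _ Dzb).
  have cr : `|zbar - c| <= 6 * r.
    have := le_trans (norm2_ge (y - c)) (le_trans (cmin _ Dzb) (norm2_le _)).
    by rewrite (distrC y zbar); have := ler_distD y zbar c; lra.
  exists c; split=> //; first by rewrite -ball_normE /=; lra.
  apply/nbhs_ballP; exists r => //= c'; rewrite -ball_normE /= => cc' Sc'; apply: cmin.
  by split=> //=; have := ler_distD c zbar c'; lra.
have dirK p h : `|p| = 1 -> H (- p) h -> `|(p, - h)| <= 1 + M.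
  move=> p1 Hh; have := HM (- p) h; rewrite normrN p1 => /(_ (lexx _) Hh) hM.
  by rewrite prod_norm_le /= p1 normrN; apply/andP; split; lra.
apply/nbhs_ballP; exists r => //= z; rewrite -ball_normE /= => zr Sz p t0 p1 t00.
have [t [tp tt0 tK]] : exists t : R, [/\ 0 < t, t <= t0 & t * K <= r].
  exists (Num.min t0 (r / K)); split; first by rewrite lt_min t00 divr_gt0.
    by rewrite ge_min lexx.
  by rewrite -ler_pdivlMr // ge_min lexx orbT.
(* The number of steps [n] is chosen with [1/n <= 3 eps^2 / K^2], so that the quadratic terms add up
   to at most [3 eps^2 t^2]. *)
have c0 : 0 < 3 * eps ^+ 2 / K ^+ 2.
  by rewrite divr_gt0 ?mulr_gt0 ?exprn_gt0.
have [N hN] := natSinv_le _ c0.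
have := hN N (leqnn _); rewrite ler_pdivlMr ?exprn_gt0 // => hNK.
pose n := N.+1; pose tau := t * n%:R^-1.
have n0 : 0 < n%:R :> R by rewrite ltr0n.
have ntau : n%:R * tau = t by rewrite /tau mulrC divfK // gt_eqF.
have tau0 : 0 < tau by rewrite /tau divr_gt0.
have tauK : tau * K ^+ 2 <= 3 * eps ^+ 2 * t.
  by rewrite /tau -mulrA [leRHS]mulrC ler_pM2l.
(* Growth of the squared distance per step: [2 tau * (3 eps t) * eps + tau^2 K^2]. The total [n u]
   is at most [6 eps^2 t^2 + 3 eps^2 t^2 = (3 eps t)^2], which closes the a priori bound [3 eps t]
   used in each step. *)
pose u := 6 * eps ^+ 2 * t * tau + tau ^+ 2 * K ^+ 2.
have u0 : 0 <= u.
  by rewrite /u addr_ge0 // !mulr_ge0 ?exprn_ge0 // ltW.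
have nu : n%:R * u <= (3 * eps * t) ^+ 2.
  have -> : n%:R * u = 6 * eps ^+ 2 * t * (n%:R * tau)
      + n%:R * tau * (tau * K ^+ 2) by rewrite /u; ring.
  rewrite ntau; have := ler_wpM2l (ltW tp) tauK.
  have -> : (3 * eps * t) ^+ 2 = 9 * eps ^+ 2 * t * t by ring.
  lra.
have zball : ball zbar r1 z by rewrite -ball_normE /=; lra.
(* After [k] steps [h] is the mean of the velocities used, and [c] is a graph point close to the
   Euler path. At [k = 0] any element of [H (- p)] serves as [h]. *)
have euler k : (k <= n)%N -> exists h c, [/\ H (- p) h, D c &
    norm2 (z + (k%:R * tau) *: (p, - h) - c) ^+ 2 <= k%:R * u].
  elim: k => [_|k IH kn].
    have [h [w [Hh _ _]]] := r1P z zball Sz p p1.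
    exists h, z; split=> //; first by split=> //=; lra.
    rewrite !mul0r scale0r addr0 subrr /norm2 /= !normr0 expr0n /= addr0 sqrtr0.
    by rewrite expr0n.
  have [h [c [Hh Dc hc]]] := IH (ltnW kn).
  move: hc; set y := z + _ => hc.
  have kt : k%:R * tau <= t.
    by rewrite -ntau ler_pM2r // ler_nat ltnW.
  have yr : `|zbar - y| <= 2 * r.
    have := ler_distD z zbar y; have -> : z - y = - ((k%:R * tau) *: (p, - h)).
      by rewrite /y opprD addNKr.
    have kt0 : 0 <= k%:R * tau by rewrite mulr_ge0 // ltW.
    rewrite normrN normrZ ger0_norm //.
    have : k%:R * tau * `|(p, - h)| <= t * (1 + M).
      by apply: ler_pM => //; exact: dirK.
    have : 0 <= t * (1 + M) by apply: mulr_ge0; lra.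
    by move: tK; rewrite KE; lra.
  have [c' [Sc' c'r1 c'min c'near]] := proj y yr.
  have d2 : norm2 (y - c') ^+ 2 <= k%:R * u.
    by apply: le_trans hc; rewrite lerXn2r ?nnegrE ?norm2_ge0 ?c'min.
  have ku : k%:R * u <= (3 * eps * t) ^+ 2.
    by apply: le_trans nu; rewrite ler_wpM2r // ler_nat ltnW.
  have d1 : norm2 (y - c') <= 3 * eps * t.
    have := le_trans d2 ku; rewrite ler_pXn2r ?nnegrE ?norm2_ge0 //.
    by rewrite !mulr_ge0 // ltW.
  have [h2 [w [Hh2 Tw hw]]] := r1P c' c'r1 Sc' p p1.
  have ipw : ip (y - c') w <= 0.
    exact: (proximal_normal_clco (gph S) y c' ipP c'near).
  have ipb : ip (y - c') (p, - h2) <= 3 * eps * t * eps.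
    have -> : (p, - h2) = w + ((p, - h2) - w) by rewrite addrC subrK.
    rewrite (ipD ipP); have := ip_le ipP (y - c') ((p, - h2) - w).
    have : norm2 (y - c') * norm2 ((p, - h2) - w) <= 3 * eps * t * eps.
      by apply: ler_pM => //; exact: norm2_ge0.
    by lra.
  have k0 : 0 < k%:R + 1 :> R by rewrite ltr_wpDl.
  (* By convexity the new mean, with weights [k/(k+1)] and [1/(k+1)], stays in [H (- p)]. *)
  have [h' Hh' h'E] : exists2 h', H (- p) h' &
      (k%:R + 1) *: h' = k%:R *: h + h2.
    exists ((k%:R / (k%:R + 1)) *: h + (1 / (k%:R + 1)) *: h2).
      apply: convex_set_comb => //; rewrite ?divr_ge0 // ?ltW //.
      by rewrite -mulrDl divff // gt_eqF.
    by rewrite scalerDr !scalerA !(mulrC (k%:R + 1)) !divfK ?gt_eqF // scale1r.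
  exists h', c'; split=> //.
    split=> //=; move: c'r1; rewrite -ball_normE /=.
    have := le_trans (norm2_ge (y - c')) (le_trans (c'min _ Dzb) (norm2_le _)).
    by rewrite (distrC y zbar); have := ler_distD y zbar c'; lra.
  have -> : z + (k.+1%:R * tau) *: (p, - h') - c' = (y - c') + tau *: (p, - h2).
    have E : (k.+1%:R * tau) *: (p, - h') =
        (k%:R * tau) *: (p, - h) + tau *: (p, - h2).
      congr pair => /=; first by rewrite -natr1; lmodule R.
      rewrite -natr1 (_ : _ *: - h' = - (tau *: ((k%:R + 1) *: h'))).
        by rewrite h'E; lmodule R.
      by lmodule R.
    by rewrite /y E; lmodule R.
  rewrite (norm2D_sqr ipP) -[k.+1%:R]natr1.
  have b2 : norm2 (p, - h2) ^+ 2 <= K ^+ 2.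
    rewrite lerXn2r ?nnegrE ?norm2_ge0 ?(ltW K0) //.
    by apply: le_trans (norm2_le _) _; rewrite KE ler_pM2l // dirK.
  have q1 := ler_wpM2l (ltW tau0) ipb.
  have tau2 : 0 <= tau ^+ 2 by rewrite exprn_ge0 // ltW.
  have q2 := ler_wpM2l tau2 b2.
  have uE : (k%:R + 1) * u = k%:R * u + 2 * (tau * (3 * eps * t * eps)) +
     tau ^+ 2 * K ^+ 2 by rewrite /u; ring.
  by rewrite uE; lra.
have [h [c [Hh [Sc _] hc]]] := euler n (leqnn n).
exists t, c; split=> //.
move: hc; rewrite ntau => /le_trans /(_ nu).
rewrite ler_pXn2r ?nnegrE ?norm2_ge0 //; last by rewrite !mulr_ge0 // ltW.
move=> /(le_trans (norm2_ge _)).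
rewrite -epsE.
rewrite prod_norm_le /= => /andP[k1 k2]; split.
  rewrite -normrN (_ : - (_ - _) = z.1 + t *: p - c.1) //.
  by lmodule R.
exists h => //; rewrite -normrN (_ : - (_ + _) = z.2 + t *: - h - c.2) //.
by lmodule R.
Qed.

(** * Assembly of the four implications *)

Theorem theorem3p5 (R : realType) (X : normedModType R)
  (Y : completeNormedModType R) (S : X -> set Y) (xbar : X) (ybar : Y)
  (Sxy : gph S (xbar, ybar))
  (Scl : locally_closed_at S (xbar, ybar))
  (H : X -> set Y) (Hph : pos_homogeneous H)
  (I : Type) (G : I -> X -> set Y) (Gph : forall i, pos_homogeneous (G i)) :
  let cond1 := pseudo_strictly_differentiable S H xbar ybar in
  let cond2 := forall (p : X) (i : I), p != 0 ->
    G i p `&` (-%R @` H (- p)) !=set0 in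
  let T := tangent_cone (gph S) in
  let clcoT := fun z : X * Y => clco (T z) in
  [/\ (* (a) *)
      finite_dim Y -> compact_valued H ->
      (forall i, exists s : nat -> X * Y,
         [/\ forall j, gph S (s j), s @ \oo --> (xbar, ybar) &
             outer_limit (fun j => T (s j)) `<=` gph (G i)]) ->
      cond1 -> cond2,
      (* (b) *)
      outer_norm H \is a fin_num -> convex_valued H -> complete_space X ->
      family_isc (@norm2 R X Y) (fun i => gph (G i)) (gph S) T (xbar, ybar) ->
      cond2 -> cond1,
      (* (a') *)
      euclidean_space X -> euclidean_space Y -> compact_valued H ->
      (forall i, exists s : nat -> X * Y,
         [/\ forall j, gph S (s j), s @ \oo --> (xbar, ybar) &
             outer_limit (fun j => clcoT (s j)) `<=` gph (G i)]) ->
      cond1 -> cond2 &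
      (* (b') *)
      euclidean_space X -> euclidean_space Y -> prefan H ->
      family_isc (@norm2 R X Y) (fun i => gph (G i)) (gph S) clcoT
        (xbar, ybar) ->
      cond2 -> cond1].
Proof.
move=> cond1 cond2 T clcoT; split.
- move=> fY cH lim psd p i _; have [s [Ss sbar sG]] := lim i.
  exact: (pseudo_strict_selection (G i) s p fY cH Hph Ss sbar sG psd).
- move=> fH cH cX isc inter.
  apply: approx_tangent_pseudo_strict => //.
  + exact: complete_seq_complete.
  + exact: completeNormedMod_seq_complete.
  + exact: (isc_approx_tangent S H I G).
- move=> eX [fY _] cH lim psd p i _; have [s [Ss sbar sG]] := lim i.
  apply: (pseudo_strict_selection (G i) s p fY cH Hph Ss sbar) psd.
  (* Since [T] is contained in [clcoT], its outer limit is the smaller one, which reduces (a') to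
     the argument for (a). *)
  apply: subset_trans sG => w [k [z [kinc Tz zw]]]; exists k, z; split=> // n.
  by apply: subset_closure; apply: sub_gen_smallest; exact: Tz.
- move=> eX eY [_ Hval fH] isc inter.
  have cH : convex_valued H by move=> w; case: (Hval w).
  apply: approx_tangent_pseudo_strict => //.
  + exact: finite_dim_seq_complete eX.1.
  + exact: completeNormedMod_seq_complete.
  + exact: (isc_clco_approx_tangent S H I G).
Qed.
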